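(* For every $n\geq 1$ there is an integer $g(n)$, depending only on $n$, with the following property. Let $\Delta\subset GL_n(\mathbb{Z})$ be any subgroup, let $a,b$ be coprime integers and $N$ a fixed positive integer. For an integer $k$ put $\Delta(k)=\Delta\cap GL_n(k\mathbb{Z})$, and let $\Delta_{a,b}$ be the subgroup of $\Delta$ generated by the subgroups $\Delta((a+bx)^N)$, $x\in\mathbb{Z}$. Then $\Delta_{a,b}$ is normal in $\Delta$ and the exponent of the quotient group $\Delta/\Delta_{a,b}$ is at most $g(n)$ (in particular it does not depend on $a$, $b$, $N$ or $\Delta$).
   Context: $GL_n(k\mathbb{Z})$ denotes the principal congruence subgroup of level $k$ in $GL_n(\mathbb{Z})$, i.e. the kernel of the reduction map $GL_n(\mathbb{Z})\to GL_n(\mathbb{Z}/k\mathbb{Z})$ (matrices congruent to the identity modulo $k$). *)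

(* Defs.v *)
From HB Require Import structures.
From mathcomp Require Import all_boot all_order all_algebra.
From mathcomp Require Import boolp classical_sets.

Set Implicit Arguments.
Unset Strict Implicit.
Unset Printing Implicit Defensive.

Import GRing.Theory.
Local Open Scope ring_scope.
Local Open Scope classical_set_scope.

Section Subgroups.
Local Open Scope group_scope.
Variable G : groupType.
Implicit Types (D H A B C S : set G).

Definition subgroup H : Prop :=
  [/\ H 1, forall x y, H x -> H y -> H (x * y) & forall x, H x -> H x^-1].

Definition generated S : set G := smallest subgroup S.

Definition normal_subgroup H D : Prop :=
  [/\ subgroup H, H `<=` D & forall x y, D x -> H y -> H (y ^ x)].

Definition setmul A B : set G := [set x * y | x in A & y in B].

(* The elements of D / H are the cosets x H with x in D; when H is normal in  *)
(* D they multiply by setmul, with H as identity, so quotient_exp H C e is    *)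
(* the e-th power of C in D / H.                                              *)
Definition cosets D H : set (set G) := [set setmul [set x] H | x in D].

Definition quotient_exp H C (e : nat) : set G := iter e (setmul C) H.

Definition kills_quotient D H (e : nat) : Prop :=
  forall C, cosets D H C -> quotient_exp H C e = H.

(* Satisfied by no e when D / H has infinite exponent. *)
Definition quotient_exponent D H (e : nat) : Prop :=
  [/\ (0 < e)%N, kills_quotient D H e
    & forall d : nat, (0 < d)%N -> kills_quotient D H d -> (e <= d)%N].

End Subgroups.

Definition GLZ (n : nat) := {A : 'M[int]_n | A \in unitmx}.

HB.instance Definition _ n := SubChoice.on (GLZ n).

Section GLZgroup.
Variable n : nat.
Implicit Types A B C : GLZ n.

Fact GLZ_mul_subproof A B : val A *m val B \in unitmx.
Proof. by rewrite unitmx_mul (valP A) (valP B). Qed.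

Fact GLZ_inv_subproof A : invmx (val A) \in unitmx.
Proof. by rewrite unitmx_inv (valP A). Qed.

Definition GLZ_mul A B : GLZ n := Sub (val A *m val B) (GLZ_mul_subproof A B).
Definition GLZ_one : GLZ n := Sub 1%:M (unitmx1 int n).
Definition GLZ_inv A : GLZ n := Sub (invmx (val A)) (GLZ_inv_subproof A).

Fact GLZ_mulA : associative GLZ_mul.
Proof. by move=> A B C; apply: val_inj; rewrite /= mulmxA. Qed.

Fact GLZ_mul1m : left_id GLZ_one GLZ_mul.
Proof. by move=> A; apply: val_inj; rewrite /= mul1mx. Qed.

Fact GLZ_mulm1 : right_id GLZ_one GLZ_mul.
Proof. by move=> A; apply: val_inj; rewrite /= mulmx1. Qed.

Fact GLZ_mulVm : left_inverse GLZ_one GLZ_inv GLZ_mul.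
Proof. by move=> A; apply: val_inj; rewrite /= mulVmx ?(valP A). Qed.

Fact GLZ_mulmV : right_inverse GLZ_one GLZ_inv GLZ_mul.
Proof. by move=> A; apply: val_inj; rewrite /= mulmxV ?(valP A). Qed.

HB.instance Definition _ := isGroup.Build (GLZ n)
  GLZ_mulA GLZ_mul1m GLZ_mulm1 GLZ_mulVm GLZ_mulmV.

End GLZgroup.

(* Level k ranges over all of int: k and - k give the same subgroup, and      *)
(* level 0 gives the trivial one, as (m %% 0)%Z = m.                           *)
Definition congruence_subgroup n (k : int) : set (GLZ n) :=
  [set A : GLZ n | forall i j, (val A i j = (1%:M : 'M_n) i j %[mod k])%Z].

Definition level_subgroup n (D : set (GLZ n)) (k : int) : set (GLZ n) :=
  D `&` congruence_subgroup k.

Definition progression_subgroup n (D : set (GLZ n)) (a b : int) (N : nat) :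
    set (GLZ n) :=
  generated (\bigcup_(x : int) level_subgroup D ((a + b * x) ^+ N)).

(* Main.v *)
From mathcomp Require Import all_boot all_order all_fingroup all_algebra.
From mathcomp Require Import all_solvable all_field all_character.
From mathcomp Require Import boolp classical_sets reals sequences exp Rstruct.
From mathcomp Require Import complex.
From mathcomp Require Import lra zify ring.
Require Import Defs.

(* A power A^e lies in Delta_{a,b} as soon as A^e = 1 modulo (a + b x)^N, so it *)
(* suffices to find, for each prime l, some m = a + b x such that the l-part    *)
(* of the order of A modulo m^N is bounded in terms of n, and trivial for large *)
(* l. By the formula for the order of GL_n(F_p) this holds when m is a product  *)
(* of primes p such that l^c does not divide p^i - 1 for i <= n. Such primes    *)
(* generate (Z/b l^c)^*: otherwise there are characters chi and psi with        *)
(* (1 - chi(p)) (1 - psi(p)) = 0 for all primes p and psi^2 nontrivial.         *)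
(* Mertens' estimates show that the sums of Re chi(d) Lambda(d) / d over d <= X *)
(* equal - v ln X + O(1) with v in {0, 1} for a nontrivial chi, and ln X + O(1) *)
(* for the trivial one. Hence v = 1 for chi psi and for chi psi^*, and summing  *)
(* |1 + chi psi + chi psi^*|^2 >= 0 gives 3 - 2 - 2 >= 0, a contradiction.      *)
(* Allowing v = 1 avoids proving that L(1, chi) does not vanish.                *)

Set Implicit Arguments.
Unset Strict Implicit.
Unset Printing Implicit Defensive.

Import Order.TTheory GRing.Theory Num.Theory ComplexField.Normc.
Local Open Scope ring_scope.

(** * The von Mangoldt function and the estimates of Chebyshev and Mertens *)

(** [subgroup_exponent_local] treats one prime l at a time: if for every l some [A ^+ (l ^ C * e)],
    with e prime to l and l^C dividing g, lies in the subgroup, then so does A^g.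
    [progression_exponent] finds such exponents at a single level m^N, with m = a + b x depending on
    l. When m is a product of primes p satisfying [good_prime], the l-part of the order of GL_n(F_p)
    divides a fixed l^C, and climbing from a modulus k to k p costs a further factor p, prime to l;
    hence C depends neither on m nor on N ([prime_to_exponentM]).

    Products of good primes reach every class prime to the modulus ([progression_prime_product]): by
    duality of finite abelian groups, a failure would give two characters whose kernels cover all
    primes not dividing the modulus, which [prime_outside_kernels] excludes. That theorem rests on
    [character_sum_dichotomy], proved from partial sums of L(1, chi), and on the estimates
    [mertens_le] and [mertens_ge]. *)

Section DivisorSums.
Variable V : nmodType.

Lemma sum_dvd_widen (F : nat -> V) n X : (0 < n <= X)%N ->
  \sum_(1 <= d < X.+1 | (d %| n)%N) F d = \sum_(1 <= d < n.+1 | (d %| n)%N) F d.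
Proof.
move=> /andP[n0 nX]; rewrite (big_cat_nat (n := n.+1)) //=.
rewrite [X in _ + X]big_nat_cond [X in _ + X]big1 ?addr0 // => d /andP[/andP[nd _] dn].
by have := dvdn_leq n0 dn; rewrite leqNgt nd.
Qed.

Lemma sum_multiples (F : nat -> V) d X : (0 < d)%N ->
  \sum_(1 <= n < X.+1 | (d %| n)%N) F n = \sum_(1 <= m < (X %/ d).+1) F (d * m)%N.
Proof.
move=> d0; elim: X => [|X IH]; first by rewrite div0n !big_geq.
rewrite big_mkcond big_nat_recr //= -big_mkcond IH divnS //.
case: ifP => [dX|_]; last by rewrite addr0.
rewrite add1n [in RHS]big_nat_recr //=; congr (_ + F _).
by have := divnS X d0; rewrite dX add1n => <-; rewrite mulnC divnK.
Qed.

(** The substitution n = d m turns the sum of a convolution up to X into a sum over d of sums up to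
    X / d. *)
Lemma sum_dvd_exchange (f : nat -> nat -> V) X :
  \sum_(1 <= n < X.+1) \sum_(1 <= d < n.+1 | (d %| n)%N) f d n =
  \sum_(1 <= d < X.+1) \sum_(1 <= m < (X %/ d).+1) f d (d * m)%N.
Proof.
transitivity (\sum_(1 <= n < X.+1) \sum_(1 <= d < X.+1 | (d %| n)%N) f d n).
  by apply: eq_big_nat => n hn; rewrite -(sum_dvd_widen _ hn).
rewrite (exchange_big_dep_nat predT) //=.
apply: eq_big_nat => d /andP[d0 _].
by rewrite -sum_multiples.
Qed.

End DivisorSums.

Section VonMangoldt.
Variable R : realType.
Implicit Types (n m d p k X : nat).

Definition lnn n : R := ln n%:R.

Lemma lnnM m n : (0 < m)%N -> (0 < n)%N -> lnn (m * n) = lnn m + lnn n.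
Proof. by move=> m0 n0; rewrite /lnn natrM lnM // posrE ltr0n. Qed.

Lemma lnn_ge0 n : 0 <= lnn n.
Proof. case: n => [|n]; first by rewrite /lnn ln0. by apply: ln_ge0; rewrite ler1n. Qed.

Lemma lnn1 : lnn 1 = 0. Proof. exact: ln1. Qed.

Lemma ler_lnn m n : (0 < m)%N -> (m <= n)%N -> lnn m <= lnn n.
Proof.
move=> m0 mn; rewrite ler_ln ?ler_nat // posrE ltr0n //.
exact: leq_trans mn.
Qed.

Lemma lnn_unbounded (C : R) : exists2 n, (0 < n)%N & C < lnn n.
Proof.
pose n := (Num.bound (expR C)).
have hn : expR C < n%:R by apply: archi_boundP; rewrite expR_ge0.
have n0 : (0 < n)%N by rewrite -(ltr0n R); apply: lt_trans hn; exact: expR_gt0.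
exists n => //; rewrite -[C](@expRK R) ltr_ln // posrE ?expR_gt0 //.
Qed.

Lemma lnnS_le n : (0 < n)%N -> n%:R * (lnn n.+1 - lnn n) <= 1.
Proof.
move=> n0; have n0R : 0 < n%:R :> R by rewrite ltr0n.
rewrite /lnn -ln_div ?posrE ?ltr0n //.
have -> : n.+1%:R / n%:R = 1 + n%:R^-1 :> R.
  by rewrite -natr1 mulrDl divff ?mul1r // gt_eqF.
rewrite mulrC -ler_pdivlMr // mul1r; apply: le_ln1Dx.
by apply: (@lt_trans _ _ 0); rewrite ?ltrN10 // invr_gt0.
Qed.

(** [primes n] lists the distinct prime divisors, so it is a singleton exactly for prime powers
    greater than 1; n = 0 falls in the default case. *)
Definition vonMangoldt n : R := if primes n is [:: p] then lnn p else 0.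

Local Notation Lambda := vonMangoldt.

Lemma vonMangoldt_ge0 n : 0 <= Lambda n.
Proof.
rewrite /vonMangoldt; case: primes => [|p [|q s]] //; exact: lnn_ge0.
Qed.

Lemma vonMangoldtX p k : prime p -> (0 < k)%N -> Lambda (p ^ k) = lnn p.
Proof. by move=> pp k0; rewrite /vonMangoldt primesX // primes_prime. Qed.

Lemma vonMangoldtP n : Lambda n != 0 -> exists p k, [/\ prime p, (0 < k)%N & n = (p ^ k)%N].
Proof.
rewrite /vonMangoldt; case E: (primes n) => [|p [|q s]]; rewrite ?eqxx // => _.
have : p \in primes n by rewrite E mem_head.
rewrite mem_primes => /and3P[pp n0 pn]; exists p, (logn p n).
split => //; first by rewrite logn_gt0 E mem_head.
rewrite {1}(prod_prime_decomp n0) prime_decompE E /= big_cons big_nil muln1.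
by rewrite /pfactor /=.
Qed.

Lemma vonMangoldt1 : Lambda 1 = 0. Proof. by []. Qed.

(** Induction on n = p m: exactly one prime power divides n but not m, namely p to the power
    [(logn p m).+1], and it contributes [lnn p]. *)
Lemma sum_vonMangoldt n : (0 < n)%N ->
  lnn n = \sum_(1 <= d < n.+1 | (d %| n)%N) Lambda d.
Proof.
elim/ltn_ind: n => n IH n0.
case: (ltngtP n 1) => [|n1|->]; first by case: (n) n0.
  have [p pp /dvdnP[m]] := pdivP n1; rewrite mulnC => nE.
  have m0 : (0 < m)%N by move: n0; rewrite nE muln_gt0 => /andP[].
  have mn : (m < n)%N by rewrite nE ltn_Pmull // prime_gt1.
  have mdn : (m %| n)%N by rewrite nE dvdn_mull.
  rewrite {1}nE lnnM ?(prime_gt0 pp) // (IH m) //.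
  rewrite -(@sum_dvd_widen _ _ m n); last by rewrite m0 ltnW.
  rewrite [in RHS](bigID (fun d => d %| m)%N) /= addrC; congr (_ + _); last first.
    apply: eq_bigl => d; apply/idP/andP => [dm|[]//].
    by split => //; apply: dvdn_trans mdn.
  set q := (p ^ (logn p m).+1)%N.
  have qn : (q %| n)%N.
    by rewrite /q nE expnS dvdn_pmul2l ?prime_gt0 // pfactor_dvdnn.
  have qm : ~~ (q %| m)%N by rewrite /q pfactor_dvdn // ltnn.
  have hq : q \in index_iota 1 n.+1.
    by rewrite mem_index_iota expn_gt0 prime_gt0 //= ltnS dvdn_leq.
  rewrite big_mkcond (bigD1_seq q hq (iota_uniq _ _)) /=.
  rewrite qn qm /= vonMangoldtX // big1 ?addr0 // => d dq.
  case: ifP => // /andP[dn dm].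
  apply: contraNeq dq => /vonMangoldtP[r [k [rp k0 dE]]].
  move: dn dm; rewrite dE !pfactor_dvdn // nE lognM ?(prime_gt0 pp) //.
  rewrite logn_prime // -ltnNge.
  case: eqP => [e|_]; last by lia.
  by rewrite /q -e => h1 h2; have -> : k = (logn r m).+1 by lia.
by rewrite big_mkcond big_nat1 lnn1 vonMangoldt1.
Qed.

Definition chebyshev X : R := \sum_(1 <= d < X.+1) Lambda d.

Lemma lnn_fact X : lnn X`! = \sum_(1 <= n < X.+1) lnn n.
Proof.
elim: X => [|X IH]; first by rewrite big_geq // fact0 lnn1.
by rewrite factS mulnC lnnM ?fact_gt0 // big_nat_recr //= IH.
Qed.

Lemma lnn_fact_vonMangoldt X :
  lnn X`! = \sum_(1 <= d < X.+1) Lambda d * (X %/ d)%:R.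
Proof.
rewrite lnn_fact.
transitivity (\sum_(1 <= n < X.+1) \sum_(1 <= d < n.+1 | (d %| n)%N) Lambda d).
  by apply: eq_big_nat => n /andP[n0 _]; apply: sum_vonMangoldt.
rewrite (sum_dvd_exchange (fun d _ => Lambda d)).
by apply: eq_bigr => d _; rewrite sumr_const_nat subn1 mulr_natr.
Qed.

Lemma lnn_fact_vonMangoldt_widen X Y : (X <= Y)%N ->
  lnn X`! = \sum_(1 <= d < Y.+1) Lambda d * (X %/ d)%:R.
Proof.
move=> XY; rewrite lnn_fact_vonMangoldt [RHS](big_cat_nat (n := X.+1)) //=.
rewrite [X in _ = _ + X]big_nat [X in _ = _ + X]big1 ?addr0 // => d /andP[Xd _].
by rewrite divn_small // mulr0.
Qed.

(* The coefficient floor(X/d) - floor(n/d) - floor((X-n)/d) of Lambda(d) in    *)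
(* ln 'C(X, n) is nonnegative, and equals 1 when n <= X - n < d <= X.          *)
Lemma chebyshev_half X :
  chebyshev X <= chebyshev (uphalf X) + X%:R * lnn 2.
Proof.
set m := uphalf X; set n := X./2.
have XE : X = (n + m)%N by rewrite /n /m uphalf_half; have := odd_double_half X; lia.
have nm : (n <= m)%N by rewrite /m uphalf_half leq_addl.
have nX : (n <= X)%N by rewrite XE leq_addr.
have mX : (m <= X)%N by rewrite XE leq_addl.
have h1 : lnn 'C(X, n) <= X%:R * lnn 2.
  have -> : X%:R * lnn 2 = lnn (2 ^ X) :> R.
    by rewrite /lnn natrX lnXn ?mulr_natl // ltr0n.
  apply: ler_lnn; first by rewrite bin_gt0.
  rewrite -[2%N]/(1 + 1)%N expnDn.
  rewrite (bigD1 (Ordinal (nX : n < X.+1)%N)) //= !exp1n !muln1.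
  exact: leq_addr.
have h2 : lnn X`! = lnn 'C(X, n) + (lnn n`! + lnn m`!).
  rewrite -(bin_fact nX) lnnM ?bin_gt0 ?muln_gt0 ?fact_gt0 // lnnM ?fact_gt0 //.
  by rewrite {2}XE addKn.
suff h3 : chebyshev X - chebyshev m <= lnn 'C(X, n) by lra.
have -> : lnn 'C(X, n) = lnn X`! - (lnn n`! + lnn m`!) by rewrite h2 addrK.
rewrite (lnn_fact_vonMangoldt X) (lnn_fact_vonMangoldt_widen nX).
rewrite (lnn_fact_vonMangoldt_widen mX) -big_split -sumrB /=.
have mX1 : (m.+1 <= X.+1)%N by rewrite ltnS.
rewrite {1}/chebyshev (big_cat_nat (n := m.+1)) //= addrAC subrr add0r.
rewrite [leRHS](big_cat_nat (n := m.+1)) //=.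
have pos d : (0 <= (X %/ d)%:R - (n %/ d)%:R - (m %/ d)%:R :> R).
  rewrite subr_ge0 lerBrDl -natrD ler_nat XE.
  by case: (posnP d) => [->|d0]; rewrite ?divn0 // divnD // leq_addr.
rewrite -[leLHS]add0r lerD //.
  apply: sumr_ge0 => d _.
  have := pos d; have := vonMangoldt_ge0 d; nra.
rewrite big_nat [leRHS]big_nat; apply: ler_sum => d /andP[md dX].
rewrite [(n %/ d)%N]divn_small ?[(m %/ d)%N]divn_small //; last first.
  exact: leq_ltn_trans md.
rewrite mulr0 addr0 subr0 ler_peMr ?vonMangoldt_ge0 // ler1n divn_gt0 //.
exact: leq_ltn_trans md.
Qed.

(** Iterated halving: with ln 2 <= 1 the bound becomes 4 (X + 1) / 2 + X = 3 X + 2, which is at most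
    4 X once X >= 2. *)
Lemma chebyshev_le X : chebyshev X <= 4 * X%:R.
Proof.
elim/ltn_ind: X => X IH.
have ln2 : lnn 2 <= 1.
  by have := lnnS_le (ltn0Sn 0); rewrite lnn1 subr0 mul1r.
case: (leqP X 1) => X1.
  case: X X1 {IH} => [|[|//]] _; first by rewrite /chebyshev big_geq // mulr0.
  by rewrite /chebyshev big_nat1 vonMangoldt1; lra.
apply: le_trans (chebyshev_half X) _.
have hX : (uphalf X < X)%N by rewrite uphalf_half; have := odd_double_half X; lia.
apply: le_trans (lerD (IH _ hX) (lexx _)) _.
have : ((uphalf X).*2 <= X.+1)%N by rewrite uphalf_half; have := odd_double_half X; lia.
rewrite -(ler_nat R) -muln2 natrM -natr1 => h.
have h2 : 2 <= X%:R :> R by rewrite ler_nat.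
have : X%:R * lnn 2 <= X%:R by rewrite ler_piMr.
lra.
Qed.

Lemma lnn_fact_ge X : X%:R * lnn X - X%:R <= lnn X`!.
Proof.
elim: X => [|X IH]; first by rewrite mul0r subr0 lnn_ge0.
rewrite factS lnnM ?fact_gt0 //.
case: X IH => [|X] IH; first by rewrite fact0 lnn1; lra.
have := @lnnS_le X.+1 isT; rewrite -(natr1 X.+1); move: IH; nra.
Qed.

Lemma lnn_fact_le X : lnn X`! <= X%:R * lnn X.
Proof.
rewrite lnn_fact; apply: (@le_trans _ _ (\sum_(1 <= n < X.+1) lnn X)).
  rewrite big_nat [leRHS]big_nat; apply: ler_sum => n /andP[n0 nX].
  exact: ler_lnn.
by rewrite sumr_const_nat subn1 mulr_natl.
Qed.

(** In the formula for ln X! the quotient X / d exceeds its integer part by at most 1; the total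
    loss is [chebyshev X], at most 4 X. *)
Lemma mertens_le X : (0 < X)%N ->
  \sum_(1 <= d < X.+1) Lambda d / d%:R <= lnn X + 4.
Proof.
move=> X0; have XR : 0 < X%:R :> R by rewrite ltr0n.
rewrite -(ler_pM2l XR).
have h : X%:R * (\sum_(1 <= d < X.+1) Lambda d / d%:R) <= lnn X`! + chebyshev X.
  rewrite lnn_fact_vonMangoldt -big_split mulr_sumr /= big_nat [leRHS]big_nat.
  apply: ler_sum => d /andP[d0 _].
  rewrite mulrCA -{3}[Lambda d]mulr1 -mulrDr ler_wpM2l ?vonMangoldt_ge0 //.
  rewrite ler_pdivrMr ?ltr0n // natr1 -natrM ler_nat ltnW //.
  by rewrite mulnC {1}(divn_eq X d) mulnS mulnC addnC ltn_add2r ltn_mod.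
have := chebyshev_le X; have := lnn_fact_le X; nra.
Qed.

Lemma mertens_ge X : (0 < X)%N ->
  lnn X - 1 <= \sum_(1 <= d < X.+1) Lambda d / d%:R.
Proof.
move=> X0; have XR : 0 < X%:R :> R by rewrite ltr0n.
rewrite -(ler_pM2l XR).
have h : lnn X`! <= X%:R * (\sum_(1 <= d < X.+1) Lambda d / d%:R).
  rewrite lnn_fact_vonMangoldt mulr_sumr /= big_nat [leRHS]big_nat.
  apply: ler_sum => d /andP[d0 _].
  rewrite mulrCA ler_wpM2l ?vonMangoldt_ge0 //.
  by rewrite ler_pdivlMr ?ltr0n // -natrM ler_nat leq_trunc_div.
have := lnn_fact_ge X; nra.
Qed.

End VonMangoldt.

(** * The Moebius function and its inversion formula *)

Section Moebius.
Variable R : realType.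
Implicit Types (n m d p : nat).
Local Notation Lambda := (vonMangoldt R).
Local Notation lnn := (lnn R).

(** The [all] test is squarefreeness. The value at 0 is 1, but the sums below start at 1. *)
Definition moebius n : R :=
  if all (fun p => logn p n == 1%N) (primes n) then (-1) ^+ size (primes n) else 0.

Lemma moebius1 : moebius 1 = 1. Proof. by []. Qed.

Lemma normr_moebius n : `|moebius n| <= 1.
Proof. by rewrite /moebius; case: ifP; rewrite ?normr0 // normrX normrN1 expr1n. Qed.

Lemma moebiusM p m : prime p -> (0 < m)%N ->
  moebius (p * m) = if (p %| m)%N then 0 else - moebius m.
Proof.
move=> pp m0; have p0 := prime_gt0 pp.
have lE q : logn q (p * m) = ((q == p) + logn q m)%N.
  rewrite lognM //; case: (boolP (prime q)) => [qp|qn]; first by rewrite logn_prime.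
  rewrite (lognE q p) (lognE q m) (negPf qn) /= !addn0; case: eqP => // qE.
  by move: qn; rewrite qE pp.
case: ifP => pm; rewrite /moebius.
  case: ifP => // /allP /(_ p).
  rewrite primesM // primes_prime // mem_head => /(_ isT).
  have : (0 < logn p m)%N by rewrite logn_gt0 mem_primes pp m0 pm.
  by rewrite lE eqxx; lia.
have pE : perm_eq (primes (p * m)) (p :: primes m).
  apply: uniq_perm; rewrite ?primes_uniq //= ?primes_uniq ?mem_primes ?pm ?andbF //.
  by move=> q; rewrite primesM // primes_prime // !inE.
rewrite (perm_all _ pE) (perm_size pE) /= lE eqxx.
have -> : logn p m = 0%N by apply/eqP; rewrite -leqn0 leqNgt logn_gt0 mem_primes pm !andbF.
rewrite eqxx /= exprS mulN1r.
have -> : all (fun q => logn q (p * m) == 1%N) (primes m)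
        = all (fun q => logn q m == 1%N) (primes m).
  apply: eq_in_all => q; rewrite mem_primes => /and3P[_ _ qm]; rewrite lE.
  by case: (q =P p) => [qp|_] //; rewrite -qp qm in pm.
by case: ifP; rewrite // oppr0.
Qed.

(** For a prime p dividing n = p m, the divisors e of m prime to p cancel against the divisors p e
    of n; the other divisors contribute 0 or are paired in this way. *)
Lemma sum_moebius n : (0 < n)%N ->
  \sum_(1 <= d < n.+1 | (d %| n)%N) moebius d = (n == 1%N)%:R.
Proof.
move=> n0; case: (ltngtP n 1) => [|n1|->]; first by case: (n) n0.
  have [p pp /dvdnP[m]] := pdivP n1; rewrite mulnC => nE.
  have p0 := prime_gt0 pp.
  have m0 : (0 < m)%N by move: n0; rewrite nE muln_gt0 => /andP[].
  rewrite (bigID (fun d => p %| d)%N) /= big_mkcondl sum_multiples //.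
  have -> : (n %/ p)%N = m by rewrite nE mulKn.
  transitivity ((\sum_(1 <= e < m.+1 | (e %| m)%N && ~~ (p %| e)%N) - moebius e) +
     \sum_(1 <= e < m.+1 | (e %| m)%N && ~~ (p %| e)%N) moebius e); last first.
    by rewrite -big_split big1 // => e _; rewrite /= addNr.
  congr (_ + _).
    rewrite [RHS]big_mkcond; apply: eq_big_nat => e /andP[e0 _].
    rewrite nE dvdn_pmul2l // moebiusM //.
    by case: (e %| m)%N; case: (p %| e)%N.
  have dE d : (d %| n)%N && ~~ (p %| d)%N = (d %| m)%N && ~~ (p %| d)%N.
    case: (boolP (p %| d)%N) => pd; rewrite ?andbF ?andbT //.
    by rewrite nE Gauss_dvdr // coprime_sym prime_coprime.
  rewrite (eq_bigl _ _ dE) big_mkcondr [RHS]big_mkcondr.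
  by rewrite sum_dvd_widen // m0 nE leq_pmull.
by rewrite big_mkcond big_nat1 moebius1.
Qed.

(** Moebius inversion of [sum_vonMangoldt] gives the sum of mu(e) ln(n / e); its ln n part vanishes,
    either because n > 1 or because ln 1 = 0. *)
Lemma sum_moebius_lnn n : (0 < n)%N ->
  - \sum_(1 <= d < n.+1 | (d %| n)%N) moebius d * lnn d = Lambda n.
Proof.
move=> n0.
have h : \sum_(1 <= e < n.+1 | (e %| n)%N) moebius e * lnn (n %/ e) = Lambda n.
  transitivity (\sum_(1 <= e < n.+1 | (e %| n)%N)
     \sum_(1 <= d < n.+1 | (e * d %| n)%N) moebius e * Lambda d).
    rewrite big_nat_cond [RHS]big_nat_cond; apply: eq_bigr => e.
    move=> /andP[/andP[e0 _] en]; rewrite -mulr_sumr; congr (_ * _).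
    have q0 : (0 < n %/ e)%N by rewrite divn_gt0 // dvdn_leq.
    rewrite (sum_vonMangoldt _ q0) -(@sum_dvd_widen _ _ _ n); last first.
      by rewrite q0 leq_div.
    by apply: eq_bigl => d; rewrite dvdn_divRL // mulnC.
  rewrite (exchange_big_dep_nat (fun d => d %| n)%N) /=; last first.
    by move=> e d _ _ _; apply: dvdn_trans; rewrite dvdn_mull.
  transitivity (\sum_(1 <= d < n.+1 | (d %| n)%N) Lambda d * ((n %/ d)%N == 1%N)%:R).
    rewrite big_nat_cond [RHS]big_nat_cond; apply: eq_bigr => d.
    move=> /andP[/andP[d0 _] dn].
    have q0 : (0 < n %/ d)%N by rewrite divn_gt0 // dvdn_leq.
    rewrite -sum_moebius // mulr_sumr -(@sum_dvd_widen _ _ _ n); last first.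
      by rewrite q0 leq_div.
    apply: eq_big => [e|e _]; last by rewrite mulrC.
    rewrite dvdn_divRL //; case: (boolP (e * d %| n)%N); rewrite ?andbF // => h.
    by rewrite (dvdn_trans _ h) // dvdn_mulr.
  rewrite big_mkcond big_nat_recr //= dvdnn divnn n0 mulr1 big_nat big1 ?add0r //.
  move=> d /andP[d0 dn]; case: ifP => // dvd; case: eqP; rewrite ?mulr0 // => h.
  by move: (divnK dvd); rewrite h; lia.
rewrite -h -sumrN.
transitivity (\sum_(1 <= d < n.+1 | (d %| n)%N) (moebius d * lnn n - moebius d * lnn d)).
  rewrite sumrB -mulr_suml sum_moebius //.
  have -> : (n == 1%N)%:R * lnn n = 0 by case: eqP => [->|_]; rewrite ?lnn1 ?mulr0 ?mul0r.
  by rewrite sumrN sub0r.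
rewrite big_nat_cond [RHS]big_nat_cond; apply: eq_bigr => d /andP[/andP[d0 _] dn].
by rewrite -mulrBr -{1}(divnK dn) lnnM ?addrK // divn_gt0 // dvdn_leq.
Qed.

End Moebius.

Section ComplexNorm.
Variable R : realType.
Local Open Scope complex_scope.

Lemma normc_real (x : R) : normc x%:C = `|x|.
Proof. by rewrite /normc /= expr0n addr0 sqrtr_sqr. Qed.

Lemma normc_ge0 (z : R[i]) : 0 <= normc z.
Proof. by case: z => a b; exact: sqrtr_ge0. Qed.

Lemma normc_triangle (z w : R[i]) : normc (z + w) <= normc z + normc w.
Proof. exact: le_normcD. Qed.

Lemma normc_opp (z : R[i]) : normc (- z) = normc z.
Proof. exact: normcN. Qed.

Lemma normc_sum (I : Type) (r : seq I) (P : pred I) (F : I -> R[i]) :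
  normc (\sum_(i <- r | P i) F i) <= \sum_(i <- r | P i) normc (F i).
Proof.
elim/big_ind2: _ => [|z x w y zx wy|//]; first by rewrite normc0.
by apply: le_trans (normc_triangle _ _) _; rewrite lerD.
Qed.

Lemma ler_Re_normc (z : R[i]) : `|complex.Re z| <= normc z.
Proof.
case: z => a b /=; rewrite -(ler_pXn2r (ltn0Sn 1)) ?nnegrE ?sqrtr_ge0 //.
by rewrite sqr_sqrtr ?addr_ge0 ?sqr_ge0 // real_normK ?num_real // lerDl sqr_ge0.
Qed.

End ComplexNorm.

(** * Character sums *)

Section CharacterSums.
Variable R : realType.
Local Open Scope complex_scope.
Implicit Types (n m d k j X : nat).
Local Notation Lambda := (vonMangoldt R).
Local Notation lnn := (lnn R).

Variables (chi : nat -> R[i]) (B : R).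
Hypothesis chi1 : chi 1 = 1.
Hypothesis chiM : forall m n, chi (m * n) = chi m * chi n.
Hypothesis chi_le1 : forall n, normc (chi n) <= 1.
Hypothesis chi_sum : forall k, normc (\sum_(0 <= n < k) chi n) <= B.

Let S k := \sum_(0 <= n < k) chi n.

Lemma character_sum_bound_ge0 : 0 <= B.
Proof. by apply: le_trans (chi_sum 0); rewrite normc_ge0. Qed.

Lemma abel_identity (f : nat -> R) j i :
  \sum_(j <= n < j + i) chi n * (f n)%:C =
  S (j + i) * (f (j + i)%N)%:C - S j * (f j)%:C +
  \sum_(j <= n < j + i) S n.+1 * (f n - f n.+1)%:C.
Proof.
elim: i => [|i IH]; first by rewrite addn0 !big_geq // subrr addr0.
rewrite addnS big_nat_recr ?leq_addr //= IH [in RHS]big_nat_recr ?leq_addr //=.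
have -> : S (j + i).+1 = S (j + i) + chi (j + i) by rewrite /S big_nat_recr.
rewrite rmorphB /=; ring.
Qed.

(** The two boundary terms give B f(k) + B f(j), and since f decreases the remaining sum telescopes
    to B (f(j) - f(k)). *)
Lemma abel_bound (f : nat -> R) j k : (j <= k)%N ->
  (forall n, (j <= n)%N -> 0 <= f n) ->
  (forall n, (j <= n)%N -> f n.+1 <= f n) ->
  normc (\sum_(j <= n < k) chi n * (f n)%:C) <= 2 * B * f j.
Proof.
move=> jk f0 fD; rewrite -(subnKC jk); set i := (k - j)%N.
rewrite abel_identity; apply: le_trans (normc_triangle _ _) _.
apply: le_trans (lerD (normc_triangle _ _) (normc_sum _ _ _)) _.
rewrite normc_opp !normcM !normc_real !ger0_norm ?f0 ?leq_addr //.
have h : \sum_(j <= n < j + i) normc (S n.+1 * (f n - f n.+1)%:C) <=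
     \sum_(j <= n < j + i) B * (f n - f n.+1).
  rewrite big_nat [leRHS]big_nat; apply: ler_sum => n /andP[jn _].
  rewrite normcM normc_real ger0_norm ?subr_ge0 ?fD //.
  by apply: ler_wpM2r (chi_sum _); rewrite subr_ge0 fD.
have e : \sum_(j <= n < j + i) B * (f n - f n.+1) = B * (f j - f (j + i)%N).
  rewrite -mulr_sumr; congr (_ * _); rewrite -[RHS]opprB -telescope_sumr ?leq_addr //.
  by rewrite -sumrN; apply: eq_bigr => n _; rewrite opprB.
rewrite e in h.
have h1 := ler_wpM2r (f0 _ (leq_addr i j)) (chi_sum (j + i)).
have h2 := ler_wpM2r (f0 _ (leqnn j)) (chi_sum j).
rewrite -/(S _) in h1; rewrite -/(S _) in h2.
have -> : 2 * B * f j = B * f (j + i)%N + B * f j + B * (f j - f (j + i)%N) by ring.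
by rewrite lerD // lerD.
Qed.

(** [F], and below [G] and [T], are the partial sums of L(1, chi), of - L'(1, chi) and of -
    (L'/L)(1, chi). *)
Let F k := \sum_(1 <= m < k.+1) chi m * (m%:R^-1 : R)%:C.

Lemma partial_sum_dist j k : (j <= k)%N -> normc (F k - F j) <= 2 * B / j.+1%:R.
Proof.
move=> jk; rewrite /F [X in X - _](big_cat_nat (n := j.+1)) //= addrAC subrr add0r.
apply: (abel_bound (f := fun m => m%:R^-1)) => // n jn; first by rewrite invr_ge0 ler0n.
have n0 : (0 < n)%N by apply: leq_trans jn.
by rewrite lef_pV2 ?posrE ?ltr0n // ler_nat.
Qed.

Let G X := \sum_(1 <= n < X.+1) chi n * (lnn n / n%:R)%:C.

Lemma sum_chi_lnn_bounded : exists C, forall X, normc (G X) <= C.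
Proof.
(* ln n / n decreases from the point where ln n >= 1; the earlier terms go into the constant
   [C0]. *)
have [j j0 hj] := lnn_unbounded (1 : R).
pose f n : R := lnn n / n%:R.
have f0 n : 0 <= f n by rewrite divr_ge0 ?lnn_ge0 ?ler0n.
pose C0 := \sum_(1 <= n < j) f n.
have le_f n : normc (chi n * (f n)%:C) <= f n.
  by rewrite normcM normc_real ger0_norm // ler_piMl.
have fD n : (j <= n)%N -> f n.+1 <= f n.
  move=> jn; have n0 : (0 < n)%N by apply: leq_trans jn.
  rewrite /f ler_pdivrMr ?ltr0n // mulrAC ler_pdivlMr ?ltr0n //.
  have := lnnS_le R n0; have := ler_lnn R j0 jn; rewrite -natr1; nra.
have C00 : 0 <= C0 by apply: sumr_ge0.
exists (C0 + 2 * B * f j) => X; rewrite /G.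
have BB := character_sum_bound_ge0.
case: (leqP X.+1 j) => Xj.
  apply: le_trans (normc_sum _ _ _) _.
  apply: (@le_trans _ _ C0); last by rewrite lerDl (mulr_ge0 (mulr_ge0 _ BB)).
  rewrite /C0 [leRHS](big_cat_nat (n := X.+1)) //=.
  rewrite -[leLHS]addr0 lerD //; last by apply: sumr_ge0.
  by apply: ler_sum.
rewrite (big_cat_nat (n := j)) //=; last exact: ltnW.
apply: le_trans (normc_triangle _ _) _; rewrite lerD //.
  by apply: le_trans (normc_sum _ _ _) _; apply: ler_sum.
by apply: (abel_bound (f := f)) => //; apply: ltnW.
Qed.

Let T X := \sum_(1 <= d < X.+1) chi d * (Lambda d / d%:R)%:C.

Lemma sum_chi_lnn_convolution X :
  G X = \sum_(1 <= d < X.+1) chi d * (Lambda d / d%:R)%:C * F (X %/ d).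
Proof.
rewrite /G.
transitivity (\sum_(1 <= n < X.+1) \sum_(1 <= d < n.+1 | (d %| n)%N)
   chi n * (Lambda d / n%:R)%:C).
  apply: eq_big_nat => n /andP[n0 _].
  by rewrite (sum_vonMangoldt _ n0) mulr_suml rmorph_sum mulr_sumr.
rewrite (sum_dvd_exchange (fun d n => chi n * (Lambda d / n%:R)%:C)).
apply: eq_bigr => d _; rewrite /F mulr_sumr; apply: eq_bigr => m _.
by rewrite chiM natrM invfM !rmorphM /=; ring.
Qed.

Lemma div_floorS_le X d : (0 < d)%N -> (0 < X)%N ->
  ((X %/ d).+1%:R)^-1 <= d%:R / X%:R :> R.
Proof.
move=> d0 X0; rewrite ler_pdivlMr ?ltr0n // mulrC ler_pdivrMr ?ltr0n //.
by rewrite -natrM ler_nat mulnC ltnW // ltn_ceil.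
Qed.

(** A finite form of - L' = L (- L'/L). Replacing each F(X / d) by F(X) in the convolution costs at
    most the sum of Lambda(d) 2 B / X, which Chebyshev's bound makes at most 8 B; [G] itself is
    bounded. *)
Lemma partial_sum_mul_bounded :
  exists C, forall X, (0 < X)%N -> normc (F X * T X) <= C.
Proof.
have [C hC] := sum_chi_lnn_bounded; exists (C + 8 * B) => X X0.
have XR : 0 < X%:R :> R by rewrite ltr0n.
have -> : F X * T X =
    G X - \sum_(1 <= d < X.+1) chi d * (Lambda d / d%:R)%:C * (F (X %/ d) - F X).
  rewrite sum_chi_lnn_convolution -sumrB /T mulr_sumr; apply: eq_bigr => d _; ring.
apply: le_trans (normc_triangle _ _) _; rewrite normc_opp lerD //.
apply: le_trans (normc_sum _ _ _) _.
apply: (@le_trans _ _ (\sum_(1 <= d < X.+1) Lambda d * (2 * B / X%:R))).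
  rewrite big_nat [leRHS]big_nat; apply: ler_sum => d /andP[d0 _].
  have dR : 0 < d%:R :> R by rewrite ltr0n.
  rewrite !normcM normc_real ger0_norm ?divr_ge0 ?vonMangoldt_ge0 ?ler0n //.
  have h1 : normc (F (X %/ d) - F X) <= 2 * B * (d%:R / X%:R).
    rewrite -normc_opp opprB; apply: le_trans (partial_sum_dist (leq_div _ _)) _.
    by rewrite ler_wpM2l ?mulr_ge0 ?character_sum_bound_ge0 // div_floorS_le.
  have h0 : 0 <= Lambda d / d%:R by rewrite divr_ge0 ?vonMangoldt_ge0 ?ler0n.
  have -> : Lambda d * (2 * B / X%:R) = Lambda d / d%:R * (2 * B * (d%:R / X%:R)).
    by field; rewrite !gt_eqF.
  apply: le_trans (ler_wpM2l h0 h1).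
  by rewrite ler_wpM2r ?normc_ge0 // ler_piMl.
rewrite -mulr_suml -/(chebyshev R X) mulrA ler_pdivrMr //.
have := chebyshev_le R X; have := character_sum_bound_ge0; nra.
Qed.

(** The sum of mu(e) (ln X - ln e) over e | n is ln X for n = 1 plus Lambda(n), so the left side is
    a convolution in which [F] appears as a factor. *)
Lemma sum_chi_moebius X : (0 < X)%N ->
  (lnn X)%:C + T X =
  \sum_(1 <= e < X.+1)
     chi e * (moebius R e * (lnn X - lnn e) / e%:R)%:C * F (X %/ e).
Proof.
move=> X0.
transitivity (\sum_(1 <= n < X.+1) \sum_(1 <= e < n.+1 | (e %| n)%N)
   chi n * (moebius R e * (lnn X - lnn e) / n%:R)%:C); last first.
  rewrite (sum_dvd_exchange
    (fun e n => chi n * (moebius R e * (lnn X - lnn e) / n%:R)%:C)).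
  apply: eq_bigr => d _; rewrite /F mulr_sumr; apply: eq_bigr => m _.
  by rewrite chiM natrM invfM !rmorphM /=; ring.
transitivity (\sum_(1 <= n < X.+1)
   chi n * (((n == 1%N)%:R * lnn X + Lambda n) / n%:R)%:C).
  under [RHS]eq_bigr do rewrite mulrDl rmorphD mulrDr.
  rewrite big_split /= -/(T X); congr (_ + _).
  rewrite big_ltn // eqxx mul1r divr1 chi1 mul1r big_nat big1 ?addr0 //.
  by move=> n /andP[n1 _]; rewrite gtn_eqF // !mul0r mulr0.
apply: eq_big_nat => n /andP[n0 _].
rewrite -mulr_sumr; congr (_ * _).
rewrite -rmorph_sum -mulr_suml; congr ((_ / _)%:C).
rewrite -(sum_moebius_lnn R n0) -(sum_moebius R n0) mulr_suml -sumrB.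
by apply: eq_bigr => e _; rewrite mulrBr.
Qed.

(** The hypothesis is the rate at which [F] tends to 0 when the series sums to 0. It bounds the e-th
    term of [sum_chi_moebius] by (ln X - ln e) 2 B / X, and the sum of ln X - ln e is X ln X - ln
    X!, at most X. *)
Lemma character_sum_zero :
  (forall k, normc (F k) <= 2 * B / k.+1%:R) ->
  forall X, (0 < X)%N -> normc ((lnn X)%:C + T X) <= 2 * B.
Proof.
move=> hF X X0; rewrite sum_chi_moebius //; apply: le_trans (normc_sum _ _ _) _.
have XR : 0 < X%:R :> R by rewrite ltr0n.
apply: (@le_trans _ _ (\sum_(1 <= e < X.+1) (lnn X - lnn e) * (2 * B / X%:R))).
  rewrite big_nat [leRHS]big_nat; apply: ler_sum => e /andP[e0 eX].
  have eR : 0 < e%:R :> R by rewrite ltr0n.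
  have l0 : 0 <= lnn X - lnn e by rewrite subr_ge0 ler_lnn.
  rewrite !normcM normc_real !normrM normfV normr_nat (ger0_norm l0).
  have h1 : normc (F (X %/ e)) <= 2 * B * (e%:R / X%:R).
    apply: le_trans (hF _) _.
    by rewrite ler_wpM2l ?mulr_ge0 ?character_sum_bound_ge0 // div_floorS_le.
  have h0 : 0 <= (lnn X - lnn e) / e%:R by rewrite divr_ge0 ?ler0n.
  have -> : (lnn X - lnn e) * (2 * B / X%:R)
     = (lnn X - lnn e) / e%:R * (2 * B * (e%:R / X%:R)).
    by field; rewrite !gt_eqF.
  apply: le_trans (ler_wpM2l h0 h1).
  rewrite ler_wpM2r ?normc_ge0 //.
  have -> a c l r : a * (c * l * r) = a * c * (l * r) :> R by ring.
  rewrite ler_piMl //.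
  by rewrite mulr_ile1 ?normc_ge0 // normr_moebius.
rewrite -mulr_suml sumrB sumr_const_nat subn1 -lnn_fact mulrA ler_pdivrMr //.
have := lnn_fact_ge R X; have := character_sum_bound_ge0; rewrite /= -mulr_natl; nra.
Qed.

(** Since [F] moves by at most 2 B / (j + 1) after j, it keeps norm at least [delta] > 0; the
    bounded product F T then bounds T. *)
Lemma character_sum_nonzero j : 2 * B / j.+1%:R < normc (F j) ->
  exists C, forall X, (0 < X)%N -> normc (T X) <= C.
Proof.
move=> hj; have [C hC] := partial_sum_mul_bounded.
pose delta := normc (F j) - 2 * B / j.+1%:R.
have d0 : 0 < delta by rewrite subr_gt0.
pose C' := \sum_(1 <= d < j.+1) Lambda d / d%:R.
have L0 d : 0 <= Lambda d / d%:R by rewrite divr_ge0 ?vonMangoldt_ge0 ?ler0n.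
have C'0 : 0 <= C' by apply: sumr_ge0.
have C0 : 0 <= C by apply: le_trans (hC 1%N isT); rewrite normc_ge0.
exists (C' + C / delta) => X X0; case: (leqP X j) => Xj.
  apply: le_trans (normc_sum _ _ _) _.
  apply: (@le_trans _ _ C'); last by rewrite lerDl divr_ge0 // ltW.
  rewrite /C' [leRHS](big_cat_nat (n := X.+1)) //=.
  rewrite -[leLHS]addr0 lerD //; last by apply: sumr_ge0.
  by apply: ler_sum => d _; rewrite normcM normc_real ger0_norm // ler_piMl.
apply: (@le_trans _ _ (C / delta)); last by rewrite lerDr.
rewrite ler_pdivlMr //; apply: le_trans (hC X X0).
rewrite normcM mulrC ler_wpM2r ?normc_ge0 // /delta.
have := partial_sum_dist (ltnW Xj).
have := normc_triangle (F j - F X) (F X); rewrite subrK -(normc_opp (F j - F X)) opprB => h1 h2.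
by rewrite lerBlDr addrC; apply: le_trans h1 _; rewrite lerD2r.
Qed.

(* v = 1 exactly when the series of the chi m / m vanishes. *)
Lemma character_sum_dichotomy : exists (v : bool) (C : R),
  forall X, (0 < X)%N ->
  `|\sum_(1 <= d < X.+1) complex.Re (chi d) * (Lambda d / d%:R) + v%:R * lnn X| <= C.
Proof.
have TE X : \sum_(1 <= d < X.+1) complex.Re (chi d) * (Lambda d / d%:R) = complex.Re (T X).
  rewrite /T raddf_sum; apply: eq_bigr => d _; case: (chi d) => x y /=.
  by rewrite mulr0 subr0.
case: (pselect (forall k, normc (F k) <= 2 * B / k.+1%:R)) => [hF|].
  exists true, (2 * B) => X X0; rewrite TE mul1r addrC.
  apply: le_trans (character_sum_zero hF X0).
  by apply: le_trans (ler_Re_normc _); case: (T X).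
move=> /existsNP[j /negP]; rewrite -ltNge => /character_sum_nonzero[C hC].
exists false, C => X X0; rewrite TE mul0r addr0.
exact: le_trans (ler_Re_normc _) (hC X X0).
Qed.

End CharacterSums.

(** * Dirichlet characters, and primes outside two kernels *)

Section DirichletCharacters.
Variable R : realType.
Local Open Scope complex_scope.
Implicit Types (n m d k p X B : nat) (chi psi : nat -> R[i]).
Local Notation Lambda := (vonMangoldt R).
Local Notation lnn := (lnn R).

Definition dirichlet_character B chi : Prop :=
  [/\ forall m n, chi (m * n)%N = chi m * chi n,
      forall n, chi (n %% B)%N = chi n,
      forall n, coprime n B -> normc (chi n) = 1
    & forall n, ~~ coprime n B -> chi n = 0].

Definition nontrivial B chi : Prop := exists2 u, coprime u B & chi u != 1.

Lemma dirichlet_character1 B chi : dirichlet_character B chi -> chi 1%N = 1.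
Proof.
move=> [cM _ c1 _]; have := c1 1%N; rewrite coprime1n => /(_ isT) h.
have n0 : chi 1%N != 0.
  by apply/eqP => e; move/eqP: h; rewrite e normc0 eq_sym oner_eq0.
by apply: (mulfI n0); rewrite -cM muln1 mulr1.
Qed.

Lemma dirichlet_character_le1 B chi n : dirichlet_character B chi -> normc (chi n) <= 1.
Proof.
move=> [_ _ c1 c0]; case: (boolP (coprime n B)) => [/c1 ->|/c0 ->] //.
by rewrite normc0.
Qed.

Lemma dirichlet_characterM B chi psi :
  dirichlet_character B chi -> dirichlet_character B psi ->
  dirichlet_character B (fun n => chi n * psi n).
Proof.
move=> [aM aP a1 a0] [bM bP b1 b0]; split => [m n|n|n h|n h].
- by rewrite aM bM; ring.
- by rewrite aP bP.
- by rewrite normcM a1 // b1 // mulr1.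
- by rewrite a0 // mul0r.
Qed.

Lemma dirichlet_character_conj B chi :
  dirichlet_character B chi -> dirichlet_character B (fun n => (chi n)^*).
Proof.
move=> [aM aP a1 a0]; split => [m n|n|n h|n h].
- by rewrite aM rmorphM.
- by rewrite aP.
- by rewrite -(a1 n h); case: (chi n) => x y /=; rewrite sqrrN.
- by rewrite a0 // rmorph0.
Qed.

(** Multiplication by a unit u with chi(u) != 1 permutes the residues, so the sum s satisfies s =
    chi(u) s. *)
Lemma dirichlet_character_period_sum B chi : (0 < B)%N ->
  dirichlet_character B chi -> nontrivial B chi ->
  \sum_(0 <= n < B) chi n = 0.
Proof.
case: B => // B _ [cM cP c1 c0] [u cu u1].
rewrite big_mkord; set s := \sum_(i < _) _.
have : s = chi u * s.
  pose f (i : 'I_B.+1) : 'I_B.+1 := inord (u * i %% B.+1).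
  have fE i : f i = (u * i %% B.+1)%N :> nat by rewrite inordK // ltn_mod.
  have fI : injective f.
    move=> i j /(congr1 val) /=; rewrite !fE => /eqP e; apply/val_inj/eqP => /=.
    wlog ij : i j e / (i <= j)%N.
      by move=> W; case/orP: (leq_total i j) => h; [|rewrite eq_sym]; apply: W;
        rewrite // eq_sym.
    rewrite eq_sym eqn_mod_dvd ?leq_mul2l ?ij ?orbT // -mulnBr in e.
    rewrite Gauss_dvdr in e; last by rewrite coprime_sym.
    have := ltn_ord j; case: (posnP (j - i)) => h; first by lia.
    by have := dvdn_leq h e; lia.
  rewrite {1}/s (reindex_inj fI) /= mulr_sumr; apply: eq_bigr => i _.
  by rewrite fE cP cM.
move/eqP; rewrite -subr_eq0 -{1}[s]mul1r -mulrBl mulf_eq0 subr_eq0.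
by rewrite eq_sym (negPf u1) => /eqP.
Qed.

Lemma dirichlet_character_sum_le B chi k : (0 < B)%N ->
  dirichlet_character B chi -> nontrivial B chi ->
  normc (\sum_(0 <= n < k) chi n) <= B%:R.
Proof.
move=> B0 hc nc; elim/ltn_ind: k => k IH; case: (ltnP k B) => kB.
  apply: le_trans (normc_sum _ _ _) _.
  apply: (@le_trans _ _ (\sum_(0 <= n < k) 1)).
    by apply: ler_sum => n _; exact: dirichlet_character_le1 hc.
  by rewrite sumr_const_nat subn0 ler_nat ltnW.
rewrite (big_cat_nat (n := B)) //= dirichlet_character_period_sum // add0r.
rewrite -{1}[B]add0n big_addn.
under eq_bigr => n _ do (case: (hc) => _ cP _ _; rewrite -cP modnDr cP).
by apply: IH; rewrite ltn_subrL B0 (leq_trans B0).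
Qed.

Definition mangoldt_sum chi X : R :=
  \sum_(1 <= d < X.+1) complex.Re (chi d) * (Lambda d / d%:R).

Lemma mangoldt_sum_dichotomy B chi : (0 < B)%N ->
  dirichlet_character B chi -> nontrivial B chi ->
  exists (v : bool) (C : R), forall X, (0 < X)%N ->
  `|mangoldt_sum chi X + v%:R * lnn X| <= C.
Proof.
move=> B0 hc nc; apply: (@character_sum_dichotomy R chi B%:R).
- exact: dirichlet_character1 hc.
- by case: hc.
- by move=> n; apply: dirichlet_character_le1 hc.
- by move=> k; apply: dirichlet_character_sum_le.
Qed.

(** The upper bound holds for either value of v because ln X >= 0, so it serves where v is
    unknown. *)
Lemma mangoldt_sum_le B chi : (0 < B)%N ->
  dirichlet_character B chi -> nontrivial B chi ->
  exists C : R, forall X, (0 < X)%N -> mangoldt_sum chi X <= C.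
Proof.
move=> B0 hc nc; have [v [C h]] := mangoldt_sum_dichotomy B0 hc nc.
exists C => X X0; have := h X X0; rewrite ler_norml => /andP[_].
have : 0 <= v%:R * lnn X by rewrite mulr_ge0 ?ler0n ?lnn_ge0.
lra.
Qed.

Definition coprime_sum B X : R :=
  \sum_(1 <= d < X.+1) (coprime d B)%:R * (Lambda d / d%:R).

Let Lambda_div_ge0 d : 0 <= Lambda d / d%:R.
Proof. by rewrite divr_ge0 ?vonMangoldt_ge0 ?ler0n. Qed.

Lemma coprime_sum_le B X : (0 < X)%N -> coprime_sum B X <= lnn X + 4.
Proof.
move=> X0; apply: le_trans (mertens_le R X0); apply: ler_sum => d _.
by rewrite ler_piMl // lern1 leq_b1.
Qed.

Lemma vonMangoldtM_le p m : prime p -> (0 < m)%N ->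
  Lambda (p * m) <= (m == 1%N)%:R * lnn p + (p %| m)%:R * Lambda m.
Proof.
move=> pp m0.
have R0 : 0 <= (m == 1%N)%:R * lnn p + (p %| m)%:R * Lambda m.
  by rewrite addr_ge0 // mulr_ge0 ?ler0n ?lnn_ge0 ?vonMangoldt_ge0.
have [->//|/vonMangoldtP[q [k [qp k0 e]]]] := eqVneq (Lambda (p * m)) 0.
have pq : p = q.
  have : (p %| q ^ k)%N by rewrite -e dvdn_mulr.
  by rewrite Euclid_dvdX // dvdn_prime2 // => /andP[/eqP].
rewrite -pq in e => {q qp pq}.
case: k k0 e => // k _ e.
have mE : m = (p ^ k)%N by apply/eqP; rewrite -(eqn_pmul2l (prime_gt0 pp)) e expnS.
rewrite e vonMangoldtX // mE; case: k {e mE} => [|k].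
  by rewrite expn0 eqxx mul1r lerDl mulr_ge0 ?ler0n ?vonMangoldt_ge0.
by rewrite vonMangoldtX // dvdn_exp // mul1r lerDr mulr_ge0 ?ler0n ?lnn_ge0.
Qed.

(** Writing d = p m, the term m = 1 is at most ln p, and the others lie among the terms of the same
    sum divided by p. So T <= ln p + T / p, and p >= 2 gives T <= 2 ln p. *)
Lemma multiples_sum_le p X : prime p ->
  \sum_(1 <= d < X.+1 | (p %| d)%N) Lambda d / d%:R <= 2 * lnn p.
Proof.
move=> pp; set T := (X in X <= _).
have p0 := prime_gt0 pp; have pR : 0 < p%:R :> R by rewrite ltr0n.
have p2 : 2 <= p%:R :> R by rewrite ler_nat prime_gt1.
have ip : 0 < p%:R^-1 :> R by rewrite invr_gt0.
have ip2 : p%:R^-1 <= 2^-1 :> R by rewrite lef_pV2 // posrE.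
have l0 := lnn_ge0 R p.
suff h : T <= lnn p + T / p%:R.
  have T0 : 0 <= T by apply: sumr_ge0.
  nra.
rewrite {1}/T sum_multiples //.
apply: (@le_trans _ _ (\sum_(1 <= m < (X %/ p).+1)
   ((m == 1%N)%:R * lnn p + (p %| m)%:R * (Lambda m / m%:R) / p%:R))).
  rewrite big_nat [leRHS]big_nat; apply: ler_sum => m /andP[m0 _].
  have mR : 0 < m%:R :> R by rewrite ltr0n.
  have := vonMangoldtM_le pp m0; set a := (m == 1%N)%:R * lnn p => h.
  have a0 : 0 <= a by rewrite mulr_ge0 ?ler0n.
  apply: (@le_trans _ _ ((a + (p %| m)%:R * Lambda m) / (p * m)%:R)).
    by rewrite ler_wpM2r // invr_ge0 ler0n.
  rewrite natrM invfM mulrDl; apply: lerD; last first.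
    by rewrite le_eqVlt; apply/orP; left; apply/eqP; field; rewrite !gt_eqF.
  rewrite ler_piMr // mulr_ile1 ?invr_ge0 ?ler0n // invf_le1 ?ler1n ?ltr0n //.
rewrite big_split /=; apply: lerD.
  case: (X %/ p)%N => [|x]; first by rewrite big_geq.
  rewrite big_ltn // eqxx mul1r big_nat big1 ?addr0 // => m /andP[m1 _].
  by rewrite gtn_eqF // mul0r.
rewrite -mulr_suml; apply: ler_wpM2r; first exact: ltW.
rewrite /T [leRHS]big_mkcond.
rewrite [leRHS](big_cat_nat (n := (X %/ p).+1)) //=; last by rewrite ltnS leq_div.
rewrite -[leLHS]addr0 lerD //; last by apply: sumr_ge0 => d _; case: ifP.
by apply: ler_sum => d _; case: ifP; rewrite ?mul1r ?mul0r.
Qed.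

(** A prime power not coprime to B is a multiple of some prime dividing B, and there are finitely
    many of these, each contributing a bounded amount. *)
Lemma coprime_sum_ge B : (0 < B)%N ->
  exists C : R, forall X, (0 < X)%N -> lnn X - C <= coprime_sum B X.
Proof.
move=> B0; exists (1 + \sum_(p <- primes B) 2 * lnn p) => X X0.
have := mertens_ge R X0.
suff : \sum_(1 <= d < X.+1) Lambda d / d%:R <=
   coprime_sum B X + \sum_(p <- primes B) 2 * lnn p by lra.
have h : \sum_(p <- primes B) \sum_(1 <= d < X.+1 | (p %| d)%N) Lambda d / d%:R
   <= \sum_(p <- primes B) 2 * lnn p.
  rewrite big_seq [leRHS]big_seq; apply: ler_sum => p.
  by rewrite mem_primes => /and3P[pp _ _]; apply: multiples_sum_le.
apply: le_trans (lerD (lexx _) h).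
under [X in _ + X]eq_bigr do rewrite big_mkcond.
rewrite exchange_big -big_split /=; apply: ler_sum => d _.
have s0 : 0 <= \sum_(p <- primes B) (if (p %| d)%N then Lambda d / d%:R else 0).
  by apply: sumr_ge0 => p _; case: ifP.
case: (boolP (coprime d B)) => [_|ncop]; first by rewrite mul1r lerDl.
rewrite mul0r add0r.
have [e|/vonMangoldtP[p [k [pp k0 e]]]] := eqVneq (Lambda d) 0.
  by apply: le_trans s0; rewrite e mul0r.
have pB : p \in primes B.
  rewrite mem_primes pp B0 /=; move: ncop; rewrite e coprime_pexpl //.
  by rewrite prime_coprime // negbK.
rewrite (big_rem p pB) /= e dvdn_exp // lerDl.
by apply: sumr_ge0 => q _; case: ifP.
Qed.

Section TwoCharacters.
Variables (B : nat) (chi psi : nat -> R[i]).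
Hypothesis B0 : (0 < B)%N.
Hypothesis hchi : dirichlet_character B chi.
Hypothesis hpsi : dirichlet_character B psi.
Hypothesis nchi : nontrivial B chi.
Hypothesis npsi : nontrivial B psi.
Hypothesis cover : forall p, prime p -> ~~ (p %| B)%N -> chi p = 1 \/ psi p = 1.

Lemma characterX (phi : nat -> R[i]) p k : dirichlet_character B phi -> phi p = 1 ->
  phi (p ^ k)%N = 1.
Proof.
move=> hphi p1; elim: k => [|k IH]; first by rewrite expn0 (dirichlet_character1 hphi).
by rewrite expnS; case: hphi => -> _ _ _; rewrite p1 IH mulr1.
Qed.

(* (1 - chi) (1 - psi) vanishes at all prime powers prime to B. *)
Lemma mangoldt_sum_cover X :
  mangoldt_sum (fun n => chi n * psi n) X =
  mangoldt_sum chi X + mangoldt_sum psi X - coprime_sum B X.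
Proof.
rewrite /mangoldt_sum /coprime_sum -big_split -sumrB /=; apply: eq_bigr => d _.
have [->|/vonMangoldtP[p [k [pp k0 e]]]] := eqVneq (Lambda d) 0.
  by rewrite mul0r !mulr0 addr0 subr0.
rewrite -mulrDl -mulrBl; congr (_ * _).
case: (boolP (coprime d B)) => [cop|ncop]; last first.
  by case: hchi hpsi => _ _ _ -> // [_ _ _ ->] //; rewrite mulr0 /= addr0 subr0.
have pB : ~~ (p %| B)%N.
  by move: cop; rewrite e coprime_pexpl // prime_coprime.
case: (cover pp pB) => /(characterX k) h; rewrite -e in h.
  by rewrite (h hchi) mul1r /= addrAC subrr add0r.
by rewrite (h hpsi) mulr1 /= addrK.
Qed.

(** [mangoldt_sum_cover] makes the sum for chi psi unbounded below. This rules out that chi psi is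
    trivial, where all terms are nonnegative, and also v = 0 in the dichotomy; v = 1 is the
    claim. *)
Lemma mangoldt_sum_mul_le :
  exists C : R, forall X, (0 < X)%N ->
  mangoldt_sum (fun n => chi n * psi n) X <= - lnn X + C.
Proof.
have [C1 h1] := mangoldt_sum_le B0 hchi nchi.
have [C2 h2] := mangoldt_sum_le B0 hpsi npsi.
have [C3 h3] := coprime_sum_ge B0.
have hM := dirichlet_characterM hchi hpsi.
have below C : ~ forall X, (0 < X)%N -> - C <= mangoldt_sum (fun n => chi n * psi n) X.
  move=> h; have [X X0] := lnn_unbounded (C1 + C2 + C + C3).
  have := h X X0; rewrite mangoldt_sum_cover.
  have := h1 X X0; have := h2 X X0; have := h3 X X0; lra.
case: (pselect (nontrivial B (fun n => chi n * psi n))) => [nM|tM].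
  have [[] [C hC]] := mangoldt_sum_dichotomy B0 hM nM.
    exists C => X X0; have := hC X X0; rewrite mul1r ler_norml => /andP[_]; lra.
  case: (below C) => X X0; have := hC X X0.
  by rewrite mul0r addr0 ler_norml => /andP[].
case: (below 0) => X X0; rewrite oppr0; apply: sumr_ge0 => d _.
apply: mulr_ge0 => //; case: (boolP (coprime d B)) => cop; last first.
  by case: hM => _ _ _ ->.
suff -> : chi d * psi d = 1 by rewrite /= ler01.
by apply/eqP/negP => h; apply: tM; exists d => //; apply/negP.
Qed.

End TwoCharacters.

Lemma normc_eq1 (x y : R) : normc (x +i* y) = 1 -> x ^+ 2 + y ^+ 2 = 1.
Proof.
by move=> /= h; rewrite -[LHS]sqr_sqrtr ?addr_ge0 ?sqr_ge0 // h expr1n.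
Qed.

(* This is |1 + z w + z w^*|^2 >= 0. *)
Lemma three_characters_ge0 (z w : R[i]) : normc z = 1 -> normc w = 1 ->
  0 <= 3 + 2 * complex.Re (z * w) + 2 * complex.Re (z * w^*) + 2 * complex.Re (w * w).
Proof.
case: z w => a b [c d] /normc_eq1 e1 /normc_eq1 e2 /=.
set s := (X in _ <= X).
have -> : s = (1 + (a * c - b * d) + (a * c + b * d)) ^+ 2
            + ((a * d + b * c) + (b * c - a * d)) ^+ 2; last first.
  by rewrite addr_ge0 ?sqr_ge0.
have -> : (1 + (a * c - b * d) + (a * c + b * d)) ^+ 2
            + ((a * d + b * c) + (b * c - a * d)) ^+ 2 =
  1 + 2 * (a * c - b * d) + 2 * (a * c + b * d) +
  2 * (a ^+ 2 + b ^+ 2) * (c ^+ 2 + d ^+ 2) +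
  2 * (a ^+ 2 + b ^+ 2) * (c ^+ 2 - d ^+ 2) by ring.
rewrite e1 e2 /s; ring.
Qed.

Theorem prime_outside_kernels B chi psi : (0 < B)%N ->
  dirichlet_character B chi -> dirichlet_character B psi ->
  nontrivial B chi -> nontrivial B (fun n => psi n * psi n) ->
  exists p, [/\ prime p, ~~ (p %| B)%N, chi p != 1 & psi p != 1].
Proof.
move=> B0 hchi hpsi nchi npsi2; apply: contrapT => nex.
have cover p : prime p -> ~~ (p %| B)%N -> chi p = 1 \/ psi p = 1.
  move=> pp pB; case: (eqVneq (chi p) 1) => [|c1]; first by left.
  case: (eqVneq (psi p) 1) => [|p1]; first by right.
  by case: nex; exists p.
have npsi : nontrivial B psi.
  case: npsi2 => u cu u1; exists u => //; apply: contraNneq u1 => ->.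
  by rewrite mulr1.
have cJ n : psi n = 1 -> (psi n)^* = 1 by move=> ->; rewrite rmorph1.
have npsiJ : nontrivial B (fun n => (psi n)^*).
  case: npsi => u cu u1; exists u => //; apply: contraNneq u1 => h.
  by rewrite -(conjcK (psi u)) h rmorph1.
have coverJ p : prime p -> ~~ (p %| B)%N -> chi p = 1 \/ (psi p)^* = 1.
  by move=> pp pB; case: (cover p pp pB) => h; [left|right; apply: cJ].
have hpsiJ := dirichlet_character_conj hpsi.
have [C1 h1] := mangoldt_sum_mul_le B0 hchi hpsi nchi npsi cover.
have [C2 h2] := mangoldt_sum_mul_le B0 hchi hpsiJ nchi npsiJ coverJ.
have [C3 h3] := mangoldt_sum_le B0 (dirichlet_characterM hpsi hpsi) npsi2.
(* The constant 12 is 3 times the 4 of [coprime_sum_le]; for this X the nonnegative sum [pos] is at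
   most (3 - 2 - 2) ln X plus the constants, which is negative. *)
have [X X0 hX] := lnn_unbounded (12 + 2 * C1 + 2 * C2 + 2 * C3).
have pos : 0 <= 3 * coprime_sum B X + 2 * mangoldt_sum (fun n => chi n * psi n) X +
   2 * mangoldt_sum (fun n => chi n * (psi n)^*) X +
   2 * mangoldt_sum (fun n => psi n * psi n) X.
  rewrite /coprime_sum /mangoldt_sum !mulr_sumr -!big_split /=.
  apply: sumr_ge0 => d _; rewrite !mulrA -!mulrDl -!mulrA.
  rewrite mulr_ge0 // ?mulr_ge0 ?vonMangoldt_ge0 ?invr_ge0 ?ler0n //.
  case: (boolP (coprime d B)) => cop; last first.
    case: hchi => _ _ _ -> //; case: hpsi => _ _ _ -> //.
    by rewrite !mul0r /= !mulr0 !addr0.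
  rewrite mulr1; case: hchi hpsi => _ _ z1 _ [_ _ w1 _].
  exact: three_characters_ge0 (z1 _ cop) (w1 _ cop).
have := coprime_sum_le B X0; have := h1 X X0; have := h2 X X0; have := h3 X X0.
move: pos hX; lra.
Qed.

End DirichletCharacters.

(** * Residues of products of primes *)

Lemma prim_root_exists (C : numClosedFieldType) n :
  (0 < n)%N -> exists z : C, n.-primitive_root z.
Proof.
move=> n0; pose p : {poly C} := 'X^n - 1.
have [r Dp] := closed_field_poly_normal p.
rewrite (monicP _) ?monicXnsubC // scale1r in Dp.
have rn1 : all n.-unity_root r by apply/allP => z; rewrite -root_prod_XsubC -Dp.
have sz_r : (n < (size r).+1)%N.
  by rewrite -(size_prod_XsubC r id) -Dp size_XnsubC.
have [|z] := hasP (has_prim_root n0 rn1 _ sz_r); last by exists z.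
by rewrite -separable_prod_XsubC -Dp separable_Xn_sub_1 // pnatr_eq0 -lt0n.
Qed.

(** The irreducible characters of the abelian group G / H are linear and their kernels meet
    trivially, so one of them is nontrivial at the coset of g. *)
Lemma abelian_character_algC (gT : finGroupType) (G H : {group gT}) g :
  abelian G -> H \subset G -> g \in G -> g \notin H ->
  exists f : gT -> algC, [/\ {in G &, {morph f : x y / (x * y)%g >-> x * y}},
    {in G, forall x, f x ^+ #|G| = 1}, {in H, forall x, f x = 1} & f g != 1].
Proof.
move=> cG sHG gG gH.
have nHG : G \subset 'N(H)%g by rewrite cents_norm //; apply: fintype.subset_trans cG (centS sHG).
have g1 : coset H g != 1%g.
  by apply: contra gH => /eqP h; apply: coset_idr h; apply: (fintype.subsetP nHG).
have [i ki] : exists i : Iirr (G / H)%G, coset H g \notin cfker 'chi_i.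
  apply/existsP; apply: contraR g1; rewrite negb_exists => /forallP h.
  suff : coset H g \in [1 coset_of H]%g by rewrite inE.
  rewrite -(TI_cfker_irr (G / H)%G); apply/bigcapP => i _.
  by have := h i; rewrite negbK.
have lin : 'chi_i \is a linear_char.
  by move/char_abelianP: (quotient_abelian H cG); apply.
have qG x : x \in G -> coset H x \in (G / H)%g by apply: mem_quotient.
exists (fun x => 'chi_i (coset H x)); split.
- move=> x y xG yG; rewrite morphM ?(fintype.subsetP nHG) //.
  by rewrite (lin_charM lin) ?qG.
- move=> x xG; rewrite -(lin_charX lin) ?qG // -morphX ?(fintype.subsetP nHG) //.
  by rewrite expg_cardG // morph1 (lin_char1 lin).
- by move=> x xH; rewrite coset_id // (lin_char1 lin).
- by move: ki; rewrite cfkerEirr inE (lin_char1 lin).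
Qed.

(** The values in [algC] are powers of a primitive root of unity z of order [#|G|]; replacing z by a
    primitive root w of [C] of the same order respects products and the value 1. *)
Lemma abelian_character (C : numClosedFieldType) (gT : finGroupType)
    (G H : {group gT}) g :
  abelian G -> H \subset G -> g \in G -> g \notin H ->
  exists f : gT -> C, [/\ {in G &, {morph f : x y / (x * y)%g >-> x * y}},
    {in G, forall x, f x ^+ #|G| = 1}, {in H, forall x, f x = 1} & f g != 1].
Proof.
move=> cG sHG gG gH.
have [f [fM fX fH fg]] := abelian_character_algC cG sHG gG gH.
have [w hw] := prim_root_exists C (cardG_gt0 G).
have [z hz] := prim_root_exists algC (cardG_gt0 G).
have kP x : exists k, x \in G -> f x = z ^+ k.
  case: (boolP (x \in G)) => xG; last by exists 0%N.
  by have [k hk] := prim_rootP hz (fX x xG); exists k.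
have [k hk] := choice kP.
have h1 x : x \in G -> (w ^+ k x == 1) = (f x == 1).
  move=> xG; rewrite (hk x xG) -(expr0 w) -(expr0 z).
  by rewrite (eq_prim_root_expr hw) (eq_prim_root_expr hz).
exists (fun x => w ^+ k x); split.
- move=> x y xG yG; rewrite -exprD; apply/eqP.
  rewrite (eq_prim_root_expr hw) -(eq_prim_root_expr hz) exprD.
  by rewrite -!hk ?groupM // fM.
- by move=> x xG; rewrite exprAC (prim_expr_order hw) expr1n.
- by move=> x xH; apply/eqP; rewrite h1 ?(fintype.subsetP sHG) // fH.
- by rewrite h1.
Qed.

Section Residues.
Variables (R : realType) (B : nat).
Hypothesis B1 : (1 < B)%N.
Local Notation gT := {unit 'Z_B}.

(** [insubd] returns 1 when n is not coprime to B. *)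
Definition residue_unit (n : nat) : gT := insubd (1%g : gT) (n%:R : 'Z_B).

Lemma val_residue_unit n : coprime n B -> val (residue_unit n) = n%:R.
Proof. by move=> cn; rewrite val_insubd unitZpE // coprime_sym cn. Qed.

Lemma residue_unitM m n : coprime m B -> coprime n B ->
  residue_unit (m * n) = (residue_unit m * residue_unit n)%g.
Proof.
move=> cm cn; apply: val_inj.
by rewrite FinRing.val_unitM !val_residue_unit ?coprimeMl ?cm // natrM.
Qed.

Lemma residue_unit1 : residue_unit 1 = 1%g.
Proof. by apply: val_inj; rewrite val_residue_unit ?coprime1n. Qed.

Lemma residue_unitP (u : gT) : exists2 n, coprime n B & u = residue_unit n.
Proof.
have hu : coprime (val u : 'Z_B) B.
  by rewrite coprime_sym -unitZpE // natr_Zp; exact: valP.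
exists (val u : 'Z_B) => //.
by apply: val_inj; rewrite val_residue_unit // natr_Zp.
Qed.

Lemma residue_unit_eq m n : coprime m B -> coprime n B ->
  residue_unit m = residue_unit n -> m = n %[mod B].
Proof.
move=> cm cn /(congr1 val); rewrite !val_residue_unit // => /(congr1 val) /=.
by rewrite !val_Zp_nat.
Qed.

Lemma dirichlet_character_exists (H : {group gT}) (g : nat) :
  coprime g B -> residue_unit g \notin H ->
  exists2 chi : nat -> R[i], dirichlet_character B chi &
    [/\ forall n, coprime n B -> residue_unit n \in H -> chi n = 1 & chi g != 1].
Proof.
move=> cg gH.
have cT : abelian [set: gT] by apply/centsP => x _ y _; apply: val_inj;
  rewrite !FinRing.val_unitM mulrC.
have [f [fM fX fH fg]] :=
  @abelian_character R[i] _ [group of [set: gT]] H _ cT (finset.subsetT _) (finset.in_setT _) gH.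
have fn u : normc (f u) = 1.
  have /(congr1 (@normc R)) := fX u (finset.in_setT _); rewrite normc1.
  have nX (z : R[i]) k : normc (z ^+ k) = normc z ^+ k.
    by elim: k => [|k IH]; rewrite ?normc1 // !exprS normcM IH.
  by rewrite nX => /eqP; rewrite pexpr_eq1 ?normc_ge0 ?cardG_gt0 // => /eqP.
exists (fun n => if coprime n B then f (residue_unit n) else 0).
  split.
  - move=> m n; rewrite coprimeMl; case cm: (coprime m B); rewrite ?mul0r //=.
    by case cn: (coprime n B); rewrite ?mulr0 //= residue_unitM // fM ?inE.
  - move=> n; rewrite coprime_modl; case: ifP => // cn; congr f; apply: val_inj.
    by rewrite !val_residue_unit ?coprime_modl // Zp_nat_mod.
  - by move=> n ->.
  - by move=> n /negPf ->.
split; last by rewrite cg.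
by move=> n cn nH; rewrite cn fH.
Qed.

(* Were the classes of the products of good primes a proper subgroup H, every   *)
(* prime would lie in H or in the subgroup K of classes of exponent e mod q.   *)
Lemma progression_prime_product (q e w a : nat) :
  (q %| B)%N -> coprime w B -> ((w * w) ^ e != 1 %[mod q])%N -> coprime a B ->
  exists2 s : seq nat,
    all (fun p => [&& prime p, ~~ (p %| B) & (p ^ e != 1 %[mod q])])%N s &
    (\prod_(p <- s) p = a %[mod B])%N.
Proof.
move=> qB cw we ca; apply: contrapT => nex.
pose good p := [&& prime p, ~~ (p %| B) & (p ^ e != 1 %[mod q])]%N.
have cop s : all good s -> coprime (\prod_(p <- s) p)%N B.
  elim: s => [|p s IH] /=; first by rewrite big_nil coprime1n.
  move=> /andP[/and3P[pp pB _] /IH h].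
  by rewrite big_cons coprimeMl h andbT prime_coprime.
pose Hset := [set u : gT | `[< exists2 s, all good s &
   u = residue_unit (\prod_(p <- s) p) >]]%SET.
have inH u : reflect (exists2 s, all good s & u = residue_unit (\prod_(p <- s) p))
    (u \in Hset) by rewrite finset.inE; apply: asboolP.
have gH : group_set Hset.
  apply/group_setP; split.
    by apply/inH; exists [::] => //; rewrite big_nil residue_unit1.
  move=> u v /inH[s hs ->] /inH[t ht ->].
  apply/inH; exists (s ++ t); first by rewrite all_cat hs.
  by rewrite big_cat /= residue_unitM ?cop.
pose Kset := [set u : gT | ((val u : 'Z_B) ^ e == 1 %[mod q])%N]%SET.
have inK n : coprime n B -> (residue_unit n \in Kset) = (n ^ e == 1 %[mod q])%N.
  move=> cn; rewrite inE val_residue_unit // val_Zp_nat //.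
  by rewrite -(modnXm e q (n %% B)) modn_dvdm // modnXm.
have gK : group_set Kset.
  apply/group_setP; split.
    by rewrite -residue_unit1 inK ?coprime1n // exp1n.
  move=> u v; have [m cm ->] := residue_unitP u; have [n cn ->] := residue_unitP v.
  rewrite -residue_unitM // !inK ?coprimeMl ?cm // expnMn => /eqP h1 /eqP h2.
  by rewrite -modnMm h1 h2 modnMm.
have aH : residue_unit a \notin Group gH.
  apply/inH => -[s hs sE]; apply: nex; exists s => //.
  by apply: residue_unit_eq; rewrite ?cop.
(* Separating the square w * w from K gives psi(w)^2 != 1, so that psi^2 is nontrivial, as
   [prime_outside_kernels] requires. *)
have wK : residue_unit (w * w) \notin Group gK by rewrite /= inK ?coprimeMl ?cw.
have [chi hchi [chi1 chia]] := dirichlet_character_exists ca aH.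
have cww : coprime (w * w) B by rewrite coprimeMl cw.
have [psi hpsi [psi1 psiw]] := dirichlet_character_exists cww wK.
have [|||p [pp pB cp pp1]] := @prime_outside_kernels R B chi psi _ hchi hpsi.
- exact: ltnW.
- by exists a.
- by exists w => //; case: hpsi => <-.
have cpB : coprime p B by rewrite prime_coprime.
(* psi is 1 on K, so psi(p) != 1 makes p good; then p lies in H, where chi is 1, against chi(p) !=
   1. *)
have gp : good p.
  rewrite /good pp pB /=; by apply: contra pp1 => h; rewrite psi1 //= inK.
case/eqP: cp; apply: chi1 => //; apply/inH.
by exists [:: p]; rewrite /= ?gp // big_seq1.
Qed.

End Residues.

(** * Congruences of integer matrices *)

Section IntegerMatrices.
Variable n : nat.
Implicit Types (A B U : 'M[int]_n.+1) (k : int) (p l e : nat).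

Definition mxcong k A := exists U, A = 1 + k *: U.

Lemma mxcongX k A e : mxcong k A -> mxcong k (A ^+ e).
Proof.
move=> [U ->]; elim: e => [|e [V IH]]; first by exists 0; rewrite scaler0 addr0.
exists (U + V + k *: (U * V)); rewrite exprS IH mulrDl mul1r mulrDr mulr1.
by rewrite -!scalerAl -!scalerAr !scalerDr !addrA; congr (_ + _); rewrite addrAC.
Qed.

(* B^p - 1 = (B - 1) (1 + B + ... + B^(p-1)), and the second factor is         *)
(* divisible by p.                                                            *)
Lemma mxcong_lift k p B : mxcong k B -> mxcong p%:Z B ->
  mxcong (k * p%:Z) (B ^+ p).
Proof.
move=> [U hU] hp.
have [W hW] : exists W, \sum_(i < p) B ^+ i = p%:Z *: W.
  suff /(_ p)[W hW] : forall m, exists W, \sum_(i < m) B ^+ i = m%:R + p%:Z *: W.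
    exists (1 + W); rewrite hW scalerDr; congr (_ + _).
    by rewrite -[LHS]scaler_nat natz.
  elim=> [|m [W IH]]; first by exists 0; rewrite big_ord0 scaler0 addr0.
  have [V hV] := mxcongX m hp.
  exists (W + V); rewrite big_ord_recr /= IH hV scalerDr -natr1.
  by rewrite !addrA; congr (_ + _); rewrite addrAC.
exists (U * W); apply/eqP; rewrite addrC -subr_eq subrX1 hW {1}hU addrAC subrr add0r.
by rewrite -scalerAl -scalerAr scalerA.
Qed.

(** The order of GL_{n+1}(F_p). *)
Definition GL_exponent p : nat :=
  (p ^ 'C(n.+1, 2) * \prod_(1 <= i < n.+2) (p ^ i - 1))%N.

Lemma mxcong_GL_exponent p A : prime p -> A \in unitmx ->
  mxcong p%:Z (A ^+ GL_exponent p).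
Proof.
move=> pp uA.
pose Ap := map_mx (intr : int -> 'F_p) A.
have uAp : Ap \is a GRing.unit.
  rewrite -[_ \is a _]/(Ap \in unitmx) unitmxE det_map_mx.
  by apply: rmorph_unit; rewrite -unitmxE.
pose u : {'GL_n.+1['F_p]} := FinRing.unit 'M['F_p]_n.+1 uAp.
have hu : (u ^+ GL_exponent p = 1)%g.
  have := @expg_cardG _ [group of 'GL_n.+1['F_p]]%g u (finset.in_setT _).
  by rewrite /= card_GL // card_Fp.
have : Ap ^+ GL_exponent p = 1.
  by have /(congr1 val) := hu; rewrite FinRing.val_unitX.
rewrite /Ap -rmorphXn /= => h.
pose M := A ^+ GL_exponent p - 1.
have dM i j : (p%:Z %| M i j)%Z.
  rewrite (dvdz_pcharf (pchar_Fp pp)).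
  have := congr1 (fun X : 'M['F_p]_n.+1 => X i j) h; rewrite mxE => hij.
  have -> : M i j = (A ^+ GL_exponent p) i j - (1%:M : 'M[int]_n.+1) i j by rewrite !mxE.
  rewrite rmorphB /= hij -[1]/(1%:M) !mxE; case: (i == j); rewrite /= ?subrr //.
exists (\matrix_(i, j) (M i j %/ p%:Z)%Z); apply/matrixP => i j.
rewrite mxE [X in _ = _ + X]mxE [X in _ = _ + _ * X]mxE mulrC divzK ?dM //.
by rewrite [M i j]mxE [X in _ = _ + (_ + X)]mxE addrC subrK.
Qed.

(** Each i <= n + 1 divides (n + 1)!, so this single condition prevents l^c from dividing any p^i -
    1 with 1 <= i <= n + 1. *)
Definition good_prime l c p :=
  [&& prime p, p != l & ~~ (p ^ (n.+1)`! == 1 %[mod l ^ c])%N].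

(** Each of the n + 1 factors p^i - 1 has l-valuation at most c - 1, and the power of p has none
    since p != l. *)
Lemma logn_GL_exponent l c p : prime l -> good_prime l c p ->
  (0 < GL_exponent p)%N && (logn l (GL_exponent p) <= n.+1 * c.-1)%N.
Proof.
move=> lp /and3P[pp pl pe].
have H m : (m <= n.+1)%N ->
    (0 < \prod_(1 <= i < m.+1) (p ^ i - 1))%N &&
    (logn l (\prod_(1 <= i < m.+1) (p ^ i - 1)) <= m * c.-1)%N.
  elim: m => [|m IH] mn; first by rewrite big_geq // logn1.
  have /andP[h1 h2] := IH (ltnW mn).
  have p1 : (1 < p ^ m.+1)%N by rewrite -{1}(expn0 p) ltn_exp2l // prime_gt1.
  have x0 : (0 < p ^ m.+1 - 1)%N by rewrite subn_gt0.
  rewrite big_nat_recr //= muln_gt0 h1 x0 /= lognM // mulSn addnC leq_add //.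
  suff : (logn l (p ^ m.+1 - 1) < c)%N by case: (c).
  rewrite ltnNge -pfactor_dvdn //; apply: contra pe.
  rewrite -eqn_mod_dvd; last exact: ltnW.
  have /dvdnP[r ->] : (m.+1 %| (n.+1)`!)%N by rewrite dvdn_fact.
  by rewrite mulnC expnM => /eqP h; rewrite -modnXm h modnXm exp1n.
have /andP[h1 h2] := H n.+1 (leqnn _).
rewrite /GL_exponent muln_gt0 expn_gt0 prime_gt0 // h1 /=.
by rewrite lognM ?expn_gt0 ?(prime_gt0 pp) // lognX logn_prime // eq_sym (negPf pl) muln0.
Qed.

(** The l-part of the order of A modulo k divides l^C. *)
Definition prime_to_exponent l C k A :=
  exists2 e, ~~ (l %| e)%N & mxcong k (A ^+ (l ^ C * e)).

(** The l-part of the group order modulo p is absorbed in the same l^C that already serves k, so C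
    does not grow; its prime-to-l part and the factor p from [mxcong_lift] go into e. *)
Lemma prime_to_exponentM l c k p A : prime l -> A \in unitmx -> good_prime l c p ->
  prime_to_exponent l (n.+1 * c.-1) k A ->
  prime_to_exponent l (n.+1 * c.-1) (k * p%:Z) A.
Proof.
move=> lp uA gp [e le he]; have /andP[E0 lE] := logn_GL_exponent lp gp.
have /and3P[pp pl _] := gp.
set C := (n.+1 * c.-1)%N in lE he *.
set E := GL_exponent p in E0 lE.
have EE : E = (l ^ logn l E * E`_l^')%N by rewrite -p_part partnC.
exists (e * E`_l^' * p)%N.
  rewrite !Euclid_dvdM // !negb_or le (dvdn_prime2 lp pp) eq_sym pl andbT /=.
  by have := part_pnat (l^')%N E; rewrite p'natE.
rewrite mulnA exprM; apply: mxcong_lift; first by rewrite mulnA exprM; apply: mxcongX.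
have -> : (l ^ C * (e * E`_l^') = E * (l ^ (C - logn l E) * e))%N.
  by rewrite {2}EE -{1}(subnKC lE) expnD; lia.
by rewrite exprM; apply: mxcongX; apply: mxcong_GL_exponent.
Qed.

Lemma prime_to_exponent_prod l c s N A : prime l -> A \in unitmx ->
  all (good_prime l c) s ->
  prime_to_exponent l (n.+1 * c.-1) ((\prod_(p <- s) p)%:Z ^+ N) A.
Proof.
move=> lp uA gs; elim: N => [|N IH].
  exists 1%N; first by rewrite dvdn1 neq_ltn prime_gt1 ?orbT.
  by exists (A ^+ (l ^ (n.+1 * c.-1) * 1) - 1); rewrite expr0 scale1r addrC subrK.
rewrite exprSr; move: (_ ^+ N) IH => k hk.
elim: s gs => [|p s IH] /=; first by rewrite big_nil mulr1.
move=> /andP[gp /IH h]; rewrite big_cons PoszM mulrCA mulrC.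
exact: prime_to_exponentM.
Qed.

End IntegerMatrices.

(** * A suitable level in the arithmetic progression *)

Section Progressions.
Variables (R : realType) (n : nat).

(* 9 ^ (n.+1)`! bounds (w * w) ^ (n.+1)`! for w = 2 and, when l = 2, w = 3;     *)
(* modulo a larger power of l these powers differ from 1.                      *)
Definition width : nat := (9 ^ (n.+1)`!)%N.
(** For l > [width] the value 1 makes [n.+1 * c.-1] vanish, so only finitely many primes contribute
    to the bound. *)
Definition cutoff l : nat := if (l <= width)%N then width else 1%N.
(** The factorial of [width] is divisible by every prime l <= [width], hence this power by every l^C
    that occurs. *)
Definition exponent_bound : nat := ((width)`! ^ (n.+1 * width))%N.

Lemma width_gt1 : (1 < width)%N.
Proof. by rewrite /width -{1}(expn0 9) ltn_exp2l // fact_gt0. Qed.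

Lemma cutoff_gt0 l : (0 < cutoff l)%N.
Proof. by rewrite /cutoff; case: ifP => // _; apply: ltnW width_gt1. Qed.

Lemma ltn_cutoff l : prime l -> (width < l ^ cutoff l)%N.
Proof.
move=> lp; rewrite /cutoff; case: (leqP l width) => h; last by rewrite expn1.
by rewrite ltn_expl // prime_gt1.
Qed.

Lemma cutoff_dvd_bound l : prime l -> (l ^ (n.+1 * (cutoff l).-1) %| exponent_bound)%N.
Proof.
move=> lp; rewrite /cutoff; case: (leqP l width) => h; last by rewrite muln0.
apply: (@dvdn_trans (l ^ (n.+1 * width))).
  by rewrite dvdn_exp2l // leq_mul2l leq_pred orbT.
by rewrite dvdn_exp2r // dvdn_fact // prime_gt0.
Qed.

(** If l divides a, it does not divide b, and a + b is prime to l. *)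
Lemma coprime_shift (a b l : nat) : prime l -> coprime a b ->
  exists2 a', coprime a' (b * l) & (a' = a %[mod b])%N.
Proof.
move=> lp cab.
have cl x : coprime x l = ~~ (l %| x)%N by rewrite coprime_sym prime_coprime.
case: (boolP (l %| a)%N) => la; last by exists a; rewrite // coprimeMr cab cl.
exists (a + b)%N; last by rewrite modnDr.
rewrite coprimeMr cl -coprime_modl modnDr coprime_modl cab /=.
rewrite dvdn_addr //; apply/negP => lb.
have : (l %| gcdn a b)%N by rewrite dvdn_gcd la.
by rewrite (eqP cab) dvdn1 => /eqP l1; rewrite l1 in lp.
Qed.

(** By the Chinese remainder theorem w can be 2 or 3 modulo l^c and 1 modulo the prime-to-l part of
    b. The power of w0 * w0 then lies strictly between 1 and l^c, so it is not 1 modulo l^c. *)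
Lemma good_witness l b : prime l -> (0 < b)%N ->
  exists2 w, coprime w (b * l) &
    ((w * w) ^ (n.+1)`! != 1 %[mod l ^ cutoff l])%N.
Proof.
move=> lp b0; pose c := cutoff l; pose w0 := if l == 2%N then 3%N else 2%N.
pose r := (b`_l^')%N.
have lr : coprime (l ^ c) r.
  by rewrite coprimeXl // prime_coprime // -p'natE // part_pnat.
pose w := chinese (l ^ c) r w0 1.
have wl : (w = w0 %[mod l ^ c])%N by rewrite /w chinese_modl.
have wr : (w = 1 %[mod r])%N by rewrite /w chinese_modr.
have w0l : coprime w0 l.
  rewrite /w0; case: eqP => [->//|/eqP l2]; rewrite prime_coprime //.
  by rewrite dvdn_prime2 // eq_sym.
have cwl : coprime w l.
  have : coprime w (l ^ c) by rewrite -coprime_modl wl coprime_modl coprimeXr.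
  by rewrite coprime_pexpr // cutoff_gt0.
exists w.
  rewrite coprimeMr cwl andbT -(partnC l b0) coprimeMr p_part coprimeXr //=.
  by rewrite -coprime_modl wr coprime_modl coprime1n.
have -> : ((w * w) ^ (n.+1)`! = (w0 * w0) ^ (n.+1)`! %[mod l ^ c])%N.
  by rewrite -modnXm -modnMm wl modnMm modnXm.
have f0 := fact_gt0 n.+1.
have lt1 : (1 < (w0 * w0) ^ (n.+1)`!)%N.
  by rewrite -{1}(expn0 (w0 * w0)) ltn_exp2l // /w0; case: eqP.
have ltc : ((w0 * w0) ^ (n.+1)`! < l ^ c)%N.
  apply: leq_ltn_trans (ltn_cutoff lp).
  by rewrite /width leq_exp2r // /w0; case: eqP.
by rewrite !modn_small ?(ltn_trans lt1) // neq_ltn lt1 orbT.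
Qed.

Lemma progression_exponent (a b : int) N l (A : 'M[int]_n.+1) :
  prime l -> coprimez a b -> A \in unitmx ->
  exists x : int, prime_to_exponent l (n.+1 * (cutoff l).-1) ((a + b * x) ^+ N) A.
Proof.
move=> lp cab uA.
have l1 : ~~ (l %| 1)%N by rewrite dvdn1 neq_ltn prime_gt1 ?orbT.
have [b0|bN0] := eqVneq b 0.
  (* For b = 0 coprimality forces a = 1 or a = -1, and every matrix is congruent to 1 modulo a^N. *)
  exists 0, 1%N => //; move: cab; rewrite b0 mul0r addr0 /coprimez gcdz0.
  set M := A ^+ _; move=> ha; have aa : a * a = 1 by move: ha; nia.
  exists (a ^+ N *: (M - 1)).
  by rewrite scalerA -exprMn aa expr1n scale1r addrC subrK.
pose c := cutoff l; pose b0 := `|b|%N.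
have b00 : (0 < b0)%N by rewrite absz_gt0.
pose a0 := `|(a %% b)%Z|%N.
have a0E : a0%:Z = (a %% b)%Z by rewrite /a0 gez0_abs // modz_ge0.
have ca0 : coprime a0 b0.
  have : coprimez (a %% b)%Z b by rewrite /coprimez gcdz_modl.
  by rewrite coprimezE.
have [a1 ca1 a1E] := coprime_shift lp ca0.
have [w cw wE] := good_witness lp b00.
(* This modulus sees both the class modulo b and the test of [good_prime] modulo l^c. *)
pose B := (b0 * l ^ c)%N.
have copB x : coprime x (b0 * l) -> coprime x B.
  by rewrite !coprimeMr => /andP[-> h]; rewrite coprimeXr.
have lcB : (l ^ c %| B)%N by rewrite dvdn_mull.
have lB : (l %| B)%N by apply: dvdn_trans lcB; rewrite dvdn_exp // cutoff_gt0.
have B0 : (0 < B)%N by rewrite muln_gt0 b00 expn_gt0 prime_gt0.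
have B1 : (1 < B)%N by apply: leq_trans (dvdn_leq B0 lB); rewrite prime_gt1.
have [s gs sE] := progression_prime_product R B1 lcB (copB _ cw) wE (copB _ ca1).
pose m := (\prod_(p <- s) p)%N.
have [x xE] : exists x, m%:Z = a + b * x.
  have h : (m = a0 %[mod b0])%N.
    by rewrite -a1E -(@modn_dvdm B m) ?dvdn_mulr // sE modn_dvdm // dvdn_mulr.
  have : (m%:Z = a0%:Z %[mod b0])%Z by rewrite !modz_nat h.
  move=> /eqP; rewrite eqz_mod_dvd a0E /b0 => h'.
  have : (b %| m%:Z - a)%Z.
    have -> : m%:Z - a = (m%:Z - (a %% b)%Z) - (a %/ b)%Z * b.
      by rewrite {1}(divz_eq a b); lia.
    apply: rpredB; last exact: dvdz_mull.
    by move: h'; rewrite !dvdzE absz_nat.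
  by move=> /dvdzP[x hx]; exists x; rewrite mulrC -hx addrC subrK.
exists x; rewrite -xE; apply: prime_to_exponent_prod => //.
apply: sub_all gs => p /and3P[pp pB pe]; apply/and3P; split => //.
by apply: contra pB => /eqP ->.
Qed.

End Progressions.

(** * Exponents of quotients, and generated subgroups *)

Section Groups.
Local Open Scope group_scope.
Variable G : groupType.
Implicit Types (D H : set G) (x y : G).

Lemma subgroupX H x k : subgroup H -> H x -> H (x ^+ k).
Proof.
move=> [H1 HM _] Hx; elim: k => [|k IH]; first by rewrite expg0.
by rewrite expgS; apply: HM.
Qed.

(** The least d > 0 with x^d in H divides every k with x^k in H. So it divides each l^C e, its
    l-part divides l^C, hence g, and all these parts together give d | g. *)
Lemma subgroup_exponent_local H x (g : nat) : subgroup H ->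
  (forall l, prime l -> exists C e : nat,
    [/\ ~~ (l %| e)%N, (l ^ C %| g)%N & H (x ^+ (l ^ C * e))]) ->
  H (x ^+ g).
Proof.
move=> sH loc; have [H1 HM HV] := sH.
pose P k := (0 < k)%N && `[< H (x ^+ k) >].
have exP : exists k, P k.
  (* The prime 2 only serves to show that some positive power of x lies in H. *)
  have [C [e [le _ h]]] := loc 2%N isT; exists (2 ^ C * e)%N.
  apply/andP; split; last exact/asboolP.
  by rewrite muln_gt0 expn_gt0 /=; case: (e) le; rewrite ?dvdn0.
case: (ex_minnP exP) => d /andP[d0 /asboolP hd] dmin.
have dvd k : H (x ^+ k) -> (d %| k)%N.
  move=> hk; rewrite /dvdn; apply: contraT; rewrite -lt0n => r0.
  have : P (k %% d)%N.
    rewrite /P r0; apply/asboolP.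
    have -> : x ^+ (k %% d) = (x ^+ d ^+ (k %/ d))^-1 * x ^+ k.
      by rewrite {3}(divn_eq k d) expgD mulnC expgM mulKg.
    by apply: HM => //; apply: HV; apply: subgroupX.
  by move/dmin; rewrite leqNgt ltn_mod d0.
have /dvdnP[q ->] : (d %| g)%N.
  apply/(dvdn_partP _ d0) => l; rewrite mem_primes => /and3P[lp _ _].
  have [C [e [le lg /dvd h]]] := loc l lp.
  rewrite p_part; apply: dvdn_trans lg; apply: dvdn_exp2l.
  have e0 : (0 < e)%N by case: (e) le; rewrite ?dvdn0.
  have := dvdn_leq_log l _ h; rewrite muln_gt0 expn_gt0 prime_gt0 // e0 => /(_ isT).
  rewrite lognM ?expn_gt0 ?(prime_gt0 lp) // pfactorK // (@lognE l e) (negPf le) !andbF.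
  by rewrite addn0.
by rewrite mulnC expgM; apply: subgroupX.
Qed.

(** Normality moves h in x h z past the power of x, so the e-th power of the coset x H is the coset
    of x^e. *)
Lemma quotient_expE D H x e : normal_subgroup H D -> subgroup D -> D x ->
  quotient_exp H (setmul [set x]%classic H) e = [set y | H ((x ^+ e)^-1 * y)]%classic.
Proof.
move=> [[H1 HM HV] HD HJ] sD Dx; rewrite /quotient_exp.
elim: e => [|e IH] /=; first by apply/seteqP; split => y /=; rewrite expg0 invg1 mul1g.
rewrite IH; apply/seteqP; split => y /=.
  move=> [c [_ -> [h Hh <-]]] [z Hz <-].
  have -> : (x ^+ e.+1)^-1 * (x * h * z) = h ^ (x ^+ e) * ((x ^+ e)^-1 * z).
    by rewrite expgS invgM conjgE -!mulgA mulKg mulKVg.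
  by apply: HM => //; apply: HJ => //; apply: subgroupX.
move=> Hy; exists x; first by exists x => //; exists 1 => //; rewrite mulg1.
by exists (x^-1 * y); rewrite ?mulKVg //= mulgA -invgM -expgS.
Qed.

Lemma quotient_exponent_le D H (g : nat) : normal_subgroup H D -> subgroup D ->
  (0 < g)%N -> (forall x, D x -> H (x ^+ g)) ->
  exists e : nat, quotient_exponent D H e /\ (e <= g)%N.
Proof.
move=> nH sD g0 hg; have [[H1 HM HV] HD HJ] := nH.
have kg : kills_quotient D H g.
  move=> _ [x Dx <-]; rewrite (quotient_expE _ nH sD Dx).
  have hx := hg x Dx; apply/seteqP; split => y /= h; last by apply: HM => //; apply: HV.
  by rewrite -[y](mulKVg (x ^+ g)); apply: HM.
pose P k := (0 < k)%N && `[< kills_quotient D H k >].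
have exP : exists k, P k by exists g; rewrite /P g0; apply/asboolP.
case: (ex_minnP exP) => e /andP[e0 /asboolP he] emin.
exists e; split; last by apply: emin; rewrite /P g0; apply/asboolP.
split => // d d0 hd; apply: emin; rewrite /P d0; exact/asboolP.
Qed.

Lemma generated_subgroup (S : set G) : subgroup (generated S).
Proof.
split.
- by move=> K [[K1 _ _] _].
- by move=> x y hx hy K hK; have [[_ KM _] _] := hK; apply: KM; [apply: hx|apply: hy].
- by move=> x hx K hK; have [[_ _ KV] _] := hK; apply: KV; apply: hx.
Qed.

Lemma sub_generated (S : set G) : (S `<=` generated S)%classic.
Proof. by move=> x Sx K [_ SK]; apply: SK. Qed.

Lemma generated_sub (S K : set G) :
  subgroup K -> (S `<=` K)%classic -> (generated S `<=` K)%classic.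
Proof. by move=> sK SK x; apply. Qed.

Lemma generated_normal D (S : set G) : subgroup D -> (S `<=` D)%classic ->
  (forall x y, D x -> S y -> S (y ^ x)) -> normal_subgroup (generated S) D.
Proof.
move=> sD SD SJ; split; first exact: generated_subgroup.
  exact: generated_sub.
move=> x y Dx; have [g1 gM gV] := generated_subgroup S.
apply: (@generated_sub S [set y | generated S (y ^ x)]%classic).
  split=> /= [|u v|u]; first by rewrite conj1g.
    by rewrite conjMg; apply: gM.
  by rewrite conjVg; apply: gV.
by move=> z Sz /=; apply: sub_generated; apply: SJ.
Qed.

End Groups.

Lemma congruence_subgroupP n k (A : GLZ n.+1) :
  congruence_subgroup k A <-> mxcong k (val A).
Proof.
split=> [h|[U hU] i j]; last first.
  by apply/eqP; rewrite eqz_mod_dvd hU !mxE addrAC subrr add0r dvdz_mulr.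
have dv i j : (k %| val A i j - (1%:M : 'M[int]_n.+1) i j)%Z.
  by rewrite -eqz_mod_dvd; apply/eqP.
exists (\matrix_(i, j) ((val A i j - (1%:M : 'M[int]_n.+1) i j) %/ k)%Z).
apply/matrixP => i j; rewrite mxE [X in _ = _ + X]mxE [X in _ = _ + _ * X]mxE.
by rewrite mulrC divzK ?dv // addrC subrK.
Qed.

Lemma val_GLZX n (A : GLZ n.+1) k : val (A ^+ k)%g = val A ^+ k.
Proof. by elim: k => [//|k IH]; rewrite expgS exprS -IH. Qed.

Lemma congruence_subgroupJ n k (A B : GLZ n.+1) :
  congruence_subgroup k A -> congruence_subgroup k (A ^ B)%g.
Proof.
move=> /congruence_subgroupP[U hU]; apply/congruence_subgroupP.
exists (val (B^-1)%g * U * val B).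
rewrite conjgE -[LHS]/(val (B^-1)%g * (val A * val B)) hU mulrDl mul1r mulrDr.
rewrite -scalerAl -scalerAr mulrA; congr (_ + _).
by rewrite -[LHS]/(val (B^-1 * B)%g) mulVg.
Qed.

Theorem theorem1p2 (n : nat) (hn : (1 <= n)%N) :
  exists g : nat,
    forall (D : set (GLZ n)) (a b : int) (N : nat),
      subgroup D -> coprimez a b -> (0 < N)%N ->
      normal_subgroup (progression_subgroup D a b N) D /\
      exists e : nat,
        quotient_exponent D (progression_subgroup D a b N) e /\ (e <= g)%N.
Proof.
(* Writing the size as a successor makes the square matrices a ring, as the lemmas on [mxcong]
   need. *)
case: n hn => // n _; exists (exponent_bound n) => D a b N sD cab _.
have [_ _ DV] := sD; have DM : forall x y, D x -> D y -> D (x * y)%g by case: sD.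
have nD : normal_subgroup (progression_subgroup D a b N) D.
  apply: generated_normal => //; first by move=> y [x _ []].
  move=> x y Dx [t _ [Dy cy]]; exists t => //; split; last exact: congruence_subgroupJ.
  by rewrite conjgE; apply: (DM) => //; [exact: DV|exact: DM].
split => //; apply: quotient_exponent_le => //.
  by rewrite expn_gt0 fact_gt0.
move=> A DA; apply: subgroup_exponent_local; first by case: nD.
move=> l lp.
(* The real field enters only through the analytic part; the standard reals instantiate it. *)
have [x [e le he]] := progression_exponent Rdefinitions.R N lp cab (valP A).
exists (n.+1 * (cutoff n l).-1)%N, e; split => //; first exact: cutoff_dvd_bound.
apply: sub_generated; exists x => //; split; first exact: subgroupX.
by apply/congruence_subgroupP; rewrite val_GLZX.
Qed.
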